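(* Every maximal $\tau$-standard chain $\underline\theta:(\theta_\ell,I_\ell)>\dots>(\theta_0,I_0)$ in $\underline W(\underline\lambda,\tau)$ (maximal among $\tau$-standard chains) has exactly one defining chain $(\bar\theta_\ell,I_\ell)>\dots>(\bar\theta_0,I_0)$, and this defining chain is a maximal chain of $W(\underline\lambda,\tau)$ (it starts at $(\tau,[m])$, ends at $(\mathrm{id}W_Q,I_0)$, and has length $r(\tau)+m-1$, where $r$ is the rank function of $W/W_Q$). Moreover, for each $k$, $\bar\theta_k$ is $Q_k$-minimal and $Q^k$-maximal, where $Q_k=\bigcap_{r=0}^kP_{I_r}$ and $Q^k=Q_\tau\cap\bigcap_{r=k}^{\ell}P_{I_r}$.
   Context: Let $\mathbb K$ be algebraically closed of characteristic zero, $G$ a connected, simply-connected, simple algebraic group over $\mathbb K$, $T\subseteq B$ maximal torus and Borel, $W$ the Weyl group, $W_\nu$ the stabilizer of a weight $\nu$. Parabolic subgroups contain $B$; $W/W_{Q'}$ carries the Bruhat order (a graded poset); for $Q_1\subseteq Q_2$, $\pi_{Q_2}:W/W_{Q_1}\to W/W_{Q_2}$ is the projection and $\min_{Q_1},\max_{Q_1}$ give the minimal/maximal preimages; an element of $W/W_{Q_1}$ is $Q_2$-minimal (resp. $Q_2$-maximal) if it lies in the image of $\min_{Q_1}$ (resp. $\max_{Q_1}$). Standing data: dominant $\lambda_1,\dots,\lambda_m$, $\underline\lambda=(\lambda_1,\dots,\lambda_m)$, $\lambda=\sum\lambda_i$, $Q=BW_\lambda B$, $\tau\in W/W_Q$;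 $Q_\tau$ is the largest parabolic containing $Q$ such that $\tau$ is $Q_\tau$-maximal. $\mathcal I$ is a set of nonempty subsets of $[m]$ ordered by inclusion, graded of length $m-1$ (so $[m]\in\mathcal I$), satisfying ( * ): $\underline J\subseteq I\Rightarrow J\subseteq I$, where $\underline J=J$ if $J$ is minimal in $\mathcal I$ and otherwise $\underline J=\bigcup\{J\setminus K:K\in\mathcal I\text{ covered by }J\}$; $\lambda_I=\sum_{i\in\underline I}\lambda_i$, $P_I=BW_{\lambda_I}B$. $W(\underline\lambda,\tau)$ is the set of pairs $(\theta,I)$ with $\theta\in W/W_Q$, $\theta\le\tau$, $I\in\mathcal I$, with product order. $\underline W(\underline\lambda,\tau)=\bigsqcup_{I\in\mathcal I}\{\theta\in W/W_{P_I}:\theta\le\pi_{P_I}(\tau)\}\times\{I\}$, ordered by the transitive closure of: $(\theta,I)\ge(\phi,J)$ iff $I\supseteq J$ and $\max_Q(\theta)\ge\min_Q(\phi)$. $\pi_{P_{\mathcal I}}(\theta,I)=(\pi_{P_I}(\theta),I)$. A chain in $\underline W(\underline\lambda,\tau)$ is $\tau$-standard if it has a defining chain: a chain in $W(\underline\lambda,\tau)$ with the same index sets, mapping elementwise onto it under $\pi_{P_{\mathcal I}}$. *)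

(* Defs.v *)
(* Weyl group of a simple simply-connected group, realised
   concretely from its Cartan matrix acting on the weight lattice Z^n
   (coordinates w.r.t. the fundamental weights), parabolic subgroups
   containing B encoded by subsets J of the simple reflections. *)
From mathcomp Require Import all_boot all_order all_algebra.
From Stdlib Require Import Relations.
Set Implicit Arguments.
Unset Strict Implicit.
Unset Printing Implicit Defensive.
Import Order.TTheory GRing.Theory Num.Theory.
Local Open Scope ring_scope.

Definition finite_type_cartan (n : nat) (C : 'M[int]_n) : Prop :=
  [/\ forall i, C i i = 2,
      forall i j, i != j -> C i j <= 0,
      forall i j, (C i j == 0) = (C j i == 0),
      forall S : {set 'I_n}, S != set0 -> S != setT ->
        exists i j, [/\ i \in S, j \notin S & C i j != 0] &
      forall S : {set 'I_n}, S != set0 ->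
        0 < \det (\matrix_(i < #|S|, j < #|S|)
                    C (enum_val (A := S) i) (enum_val (A := S) j))].

Section Weyl.
Variable n : nat.
Variable C : 'M[int]_n.

(* simple reflection s_i acting on column weight vectors:
   s_i v = v - v_i alpha_i, alpha_i = col i C *)
Definition sref (i : 'I_n) : 'M[int]_n := 1%:M - C *m delta_mx i i.
Definition wordmx (s : seq 'I_n) : 'M[int]_n :=
  foldr (fun i M => sref i *m M) 1%:M s.
Definition inW (w : 'M[int]_n) : Prop := exists s, wordmx s = w.

Definition len_le (u v : 'M[int]_n) : Prop :=
  exists t, wordmx t = u /\ forall s, wordmx s = v -> (size t <= size s)%N.
Definition len_lt (u v : 'M[int]_n) : Prop :=
  exists t, wordmx t = u /\ forall s, wordmx s = v -> (size t < size s)%N.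
Definition is_length (w : 'M[int]_n) (k : nat) : Prop :=
  (exists s, wordmx s = w /\ size s = k) /\
  forall s, wordmx s = w -> (k <= size s)%N.

Definition reflection (t : 'M[int]_n) : Prop :=
  exists s i, t = wordmx s *m sref i *m wordmx (rev s).
Definition bruhat_step (u w : 'M[int]_n) : Prop :=
  inW u /\ exists t, [/\ reflection t, w = u *m t & len_lt u w].
Definition bruhat (u w : 'M[int]_n) : Prop :=
  inW u /\ clos_refl_trans _ bruhat_step u w.

Definition inWJ (J : {set 'I_n}) (x : 'M[int]_n) : Prop :=
  exists s, all (fun i => i \in J) s /\ wordmx s = x.
Definition same_coset (J : {set 'I_n}) (u v : 'M[int]_n) : Prop :=
  exists x, inWJ J x /\ v = u *m x.
(* W/W_J is represented by minimal length coset representatives;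
   its Bruhat order is the Bruhat order of W on these representatives. *)
Definition minrep (J : {set 'I_n}) (w : 'M[int]_n) : Prop :=
  inW w /\ forall x, inWJ J x -> len_le w (w *m x).
Definition proj (J2 : {set 'I_n}) (u v : 'M[int]_n) : Prop :=
  minrep J2 v /\ same_coset J2 u v.
Definition isMinJ (J1 J2 : {set 'I_n}) (th : 'M[int]_n) : Prop :=
  minrep J1 th /\ forall th', minrep J1 th' -> same_coset J2 th th' -> bruhat th th'.
Definition isMaxJ (J1 J2 : {set 'I_n}) (th : 'M[int]_n) : Prop :=
  minrep J1 th /\ forall th', minrep J1 th' -> same_coset J2 th th' -> bruhat th' th.
End Weyl.

Section Index.
Variable m : nat.
Variable II : {set {set 'I_m}}.

Definition covby (J K : {set 'I_m}) : bool :=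
  [&& J \in II, K \in II, J \proper K &
      [forall L in II, ~~ ((J \proper L) && (L \proper K))]].
Definition minimalI (J : {set 'I_m}) : bool := [forall K in II, ~~ (K \proper J)].
Definition maximalI (J : {set 'I_m}) : bool := [forall K in II, ~~ (J \proper K)].
Definition underline (J : {set 'I_m}) : {set 'I_m} :=
  if minimalI J then J else \bigcup_(K in II | covby K J) (J :\: K).

Definition index_family : Prop :=
  [/\ forall I, I \in II -> I != set0,
      setT \in II,
      exists rk : {set 'I_m} -> nat,
        [/\ forall I, I \in II -> minimalI I -> rk I = 0%N,
            forall J K, covby J K -> rk K = (rk J).+1 &
            forall I, I \in II -> maximalI I -> rk I = m.-1] &
      forall I J, I \in II -> J \in II -> underline J \subset I -> J \subset I].
End Index.

Section Chains.
Variables (n : nat) (C : 'M[int]_n) (m : nat) (II : {set {set 'I_m}}).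
Variable lam : 'I_m -> 'I_n -> nat.   (* dominant weights lambda_1..lambda_m *)
Variable tau : 'M[int]_n.

(* P_I = B W_{lambda_I} B  <->  J = {j | (lambda_I)_j = 0} *)
Definition JP (I : {set 'I_m}) : {set 'I_n} :=
  [set j | \sum_(i in underline II I) lam i j == 0%N].
(* Q = B W_lambda B *)
Definition JQ : {set 'I_n} := [set j | \sum_i lam i j == 0%N].

Definition elt := ('M[int]_n * {set 'I_m})%type.
Definition elt0 : elt := (1%:M, set0).

Definition inWl (p : elt) : Prop :=
  [/\ minrep C JQ p.1, bruhat C p.1 tau & p.2 \in II].
Definition le_prod (p q : elt) : Prop := bruhat C p.1 q.1 /\ p.2 \subset q.2.
Definition lt_prod (p q : elt) : Prop := le_prod p q /\ p <> q.

Definition inUW (p : elt) : Prop :=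
  [/\ p.2 \in II, minrep C (JP p.2) p.1 &
      exists t, proj C (JP p.2) tau t /\ bruhat C p.1 t].
Definition ge_base (p q : elt) : Prop :=
  [/\ inUW p, inUW q, q.2 \subset p.2 &
      exists mx mn,
        [/\ isMaxJ C JQ (JP p.2) mx, same_coset C (JP p.2) mx p.1,
            isMinJ C JQ (JP q.2) mn, same_coset C (JP q.2) mn q.1 &
            bruhat C mn mx]].
Definition uge (p q : elt) : Prop := clos_trans _ ge_base p q.
Definition ugt (p q : elt) : Prop := uge p q /\ p <> q.

(* chains are listed from bottom (index 0) to top *)
Definition uchain (c : seq elt) : Prop :=
  (forall p, p \in c -> inUW p) /\
  forall k, (k.+1 < size c)%N -> ugt (nth elt0 c k.+1) (nth elt0 c k).
Definition Wchain (d : seq elt) : Prop :=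
  (forall p, p \in d -> inWl p) /\
  forall k, (k.+1 < size d)%N -> lt_prod (nth elt0 d k) (nth elt0 d k.+1).

Definition defining (c d : seq elt) : Prop :=
  [/\ size d = size c, Wchain d &
      forall k, (k < size c)%N ->
        (nth elt0 d k).2 = (nth elt0 c k).2 /\
        proj C (JP (nth elt0 c k).2) (nth elt0 d k).1 (nth elt0 c k).1].
Definition tau_standard (c : seq elt) : Prop :=
  uchain c /\ exists d, defining c d.
Definition maximal_standard (c : seq elt) : Prop :=
  tau_standard c /\
  forall c', tau_standard c' -> {subset c <= c'} -> {subset c' <= c}.
Definition Wmaximal (d : seq elt) : Prop :=
  Wchain d /\ forall d', Wchain d' -> {subset d <= d'} -> {subset d' <= d}.

Definition IsQtau (J : {set 'I_n}) : Prop :=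
  [/\ JQ \subset J, isMaxJ C JQ J tau &
      forall J' : {set 'I_n}, JQ \subset J' -> isMaxJ C JQ J' tau -> J' \subset J].

Definition Qlow (c : seq elt) (k : nat) : {set 'I_n} :=
  \bigcap_(r < size c | (r <= k)%N) JP (nth elt0 c r).2.
Definition Qhigh (Jt : {set 'I_n}) (c : seq elt) (k : nat) : {set 'I_n} :=
  Jt :&: \bigcap_(r < size c | (k <= r)%N) JP (nth elt0 c r).2.
End Chains.

(* Main.v *)
Require Import Defs.
From mathcomp Require Import all_boot all_order all_fingroup all_algebra.
From mathcomp Require Import zify ring.
From Stdlib Require Import Relations ClassicalEpsilon.
Set Implicit Arguments.
Unset Strict Implicit.
Unset Printing Implicit Defensive.
Import Order.TTheory GRing.Theory Num.Theory.
Local Open Scope ring_scope.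

(** Cosets modulo the stabiliser of a dominant weight [mu] are the points of its
    orbit, so [theta] and [theta t] have the same image in W/W_{P_I} exactly when
    the reflection [t] fixes [lambda_I].  Extend a defining chain of a maximal
    standard chain [c] to a maximal chain [e] of the graded poset W(lambda, tau);
    by maximality of [c] the image of [e] is [c].  Call a step of [e] collapsing
    when its ends have the same image; it is of the form
    (theta, I) < (theta t, I) with [t] fixing [lambda_I].  In a length two interval
    a collapsing step can be exchanged with a neighbouring noncollapsing one: there
    is a second middle element, and unless it realises the exchange it would
    enlarge [c]; moving downwards, the exchange keeps [t].  So all collapsing
    steps can be pushed to the top, and the lowest one can then be carried to the
    bottom, whence [t] fixes [lambda_I] for all I of a maximal chain of index sets.
    Then [t] lies in W_Q, which is absurd: nothing collapses, and [e] is the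
    defining chain.  It is unique because t lambda_I = t' lambda_I <> lambda_I
    forces t = t' for reflections.  Finally, replacing the first k + 1 elements by
    their minimal representatives modulo Q_k (the last ones by their maximal
    representatives modulo Q^k) gives a defining chain again, hence the same one.

    The Coxeter theory is obtained from the Cartan matrix: positivity of its
    principal minors makes it symmetrizable, with a positive definite form which
    bounds the group and forces every root to be positive or negative. *)

(** * Cartan matrices of finite type *)

Section PMatrix.
Variable (F : realFieldType).

(** Expand both determinants along row [i]: only the diagonal entry changes, and its cofactor has
    sign +1. *)
Lemma det_add_delta n (A : 'M[F]_n.+1) (i : 'I_n.+1) (a : F) :
  \det (A + a *: delta_mx i i) = \det A + a * \det (row' i (col' i A)).
Proof.
rewrite (expand_det_row (A + _) i) (expand_det_row A i).
rewrite (bigD1 i) //= [in RHS](bigD1 i) //=.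
have co j : cofactor (A + a *: delta_mx i i) i j = cofactor A i j.
  rewrite /cofactor; congr (_ * \det _); apply/matrixP=> x y.
  by rewrite !mxE eq_sym (negPf (neq_lift _ _)) /= mulr0 addr0.
have -> : \det (row' i (col' i A)) = cofactor A i i.
  by rewrite /cofactor -signr_odd addnn odd_double expr0 mul1r.
rewrite !mxE !eqxx /= mulr1 co mulrDl -!addrA; congr (_ + _).
rewrite addrC; congr (_ + _); apply: eq_bigr => j ji.
by rewrite !mxE (negPf ji) andbF mulr0 addr0 co.
Qed.

(** The P-matrix condition. Indexing minors by injections rather than subsets lets submatrices
    inherit it by composition. *)
Definition principal_pos n (A : 'M[F]_n) :=
  forall k (f : 'I_k -> 'I_n), injective f -> 0 < \det (mxsub f f A).

(** By [det_add_delta] each new diagonal entry adds a nonnegative multiple of a determinant of the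
    same kind, one size smaller. *)
Lemma principal_pos_diag n (A : 'M[F]_n) (d : 'I_n -> F) :
  principal_pos A -> (forall i, 0 <= d i) ->
  0 < \det (A + \sum_i d i *: delta_mx i i).
Proof.
elim: n A d => [|n IHn] A d Apos d0; first by rewrite det_mx00.
suff H (s : seq 'I_n.+1) : uniq s -> 0 < \det (A + \sum_(i <- s) d i *: delta_mx i i).
  by have := H (index_enum _) (index_enum_uniq _).
elim: s => [|i s IHs] /= => [_|/andP[is_ us]].
  rewrite big_nil addr0.
  suff -> : A = mxsub id id A by apply: Apos.
  by apply/matrixP=> x y; rewrite !mxE.
rewrite big_cons [_ *: _ + _]addrC addrA det_add_delta.
apply: ltr_wpDr (IHs us); apply: mulr_ge0 => //; apply: ltW.
(* [d'] records the diagonal entries already added that survive the deletion of row and column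
   [i]. *)
set A' := row' i (col' i A); pose d' j := if lift i j \in s then d (lift i j) else 0.
suff -> : row' i (col' i (A + \sum_(i <- s) d i *: delta_mx i i)) =
          A' + \sum_j d' j *: delta_mx j j.
  apply: IHn => [k f f_inj|j]; last by rewrite /d'; case: ifP.
  have -> : mxsub f f A' = mxsub (lift i \o f) (lift i \o f) A.
    by apply/matrixP=> x y; rewrite !mxE.
  by apply: Apos => x y /lift_inj /f_inj.
apply/matrixP=> x y; rewrite !mxE; congr (_ + _).
rewrite !summxE.
under eq_bigr do rewrite !mxE.
under [RHS]eq_bigr do rewrite !mxE.
rewrite [RHS](bigD1 x) //= eqxx [X in _ = _ + X]big1 ?addr0; last first.
  by move=> j jx; rewrite [x == j]eq_sym (negPf jx) /= mulr0.
rewrite /d'; case: ifP => xs.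
  rewrite (bigD1_seq (lift i x)) //= eqxx big1_seq ?addr0 => [|j /andP[jx _]].
    by rewrite (inj_eq lift_inj) eq_sym.
  by rewrite [_ == j]eq_sym (negPf jx) mulr0.
rewrite mul0r big1_seq // => j /andP[_ js].
case: eqP => [E|_]; last by rewrite /= mulr0.
by rewrite -E xs in js.
Qed.

(* A P-matrix never reverses the sign of a vector: on the support of [v],
   [diag (- (A v)_i / v_i)] is nonnegative and [A] plus it would kill [v]. *)
Lemma principal_pos_sign n (A : 'M[F]_n) (v : 'cV[F]_n) :
  principal_pos A -> (forall i, v i 0 * (A *m v) i 0 <= 0) -> v = 0.
Proof.
move=> Apos H; apply/eqP/negPn/negP=> v0.
pose S := [set i | v i 0 != 0].
pose f : 'I_#|S| -> 'I_n := fun i => enum_val i.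
have vf i : v (f i) 0 != 0 by have := enum_valP i; rewrite inE.
pose u : 'cV_#|S| := \col_i v (f i) 0.
pose d i := - ((A *m v) (f i) 0 / v (f i) 0).
have d0 i : 0 <= d i.
  rewrite /d oppr_ge0; have := H (f i); have := vf i.
  set a := v _ _; set b := (A *m v) _ _ => a0 ab.
  have -> : b / a = (a * b) / (a ^+ 2) by field.
  by rewrite mulr_le0_ge0 // invr_ge0 sqr_ge0.
have Bpos : principal_pos (mxsub f f A).
  move=> k g ginj.
  have -> : mxsub g g (mxsub f f A) = mxsub (f \o g) (f \o g) A.
    by apply/matrixP=> x y; rewrite !mxE.
  by apply: Apos => x y /enum_val_inj /ginj.
have := principal_pos_diag Bpos d0.
set B := (_ + _) => Bdet.
have Bu : B *m u = 0.
  apply/matrixP=> i j; rewrite !mxE (ord1 j).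
  have -> : \sum_k B i k * u k 0 = \sum_k A (f i) (f k) * v (f k) 0 + d i * v (f i) 0.
    have -> : d i * v (f i) 0 = \sum_k (if k == i then d i * v (f k) 0 else 0).
      by rewrite -big_mkcond big_pred1_eq.
    rewrite -big_split; apply: eq_bigr => k _ /=.
    rewrite !mxE mulrDl; congr (_ + _).
    rewrite summxE (bigD1 i) //= !mxE eqxx /= big1 ?addr0.
      by case: eqVneq => _; rewrite /= ?mulr1 ?mulr0 ?mul0r.
    by move=> l li; rewrite !mxE [i == l]eq_sym (negPf li) mulr0.
  rewrite /d mulNr mulfVK //.
  rewrite !mxE (bigID (mem S)) /= [X in _ - (_ + X)]big1 ?addr0; last first.
    by move=> k; rewrite inE negbK => /eqP->; rewrite mulr0.
  rewrite [X in _ - X]big_enum_val /=.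
  by apply/eqP; rewrite subr_eq0; apply/eqP; apply: eq_bigr.
have uB : B \in unitmx by rewrite unitmxE unitfE gt_eqF.
have u0 : u = 0 by rewrite -(mulKmx uB u) Bu mulmx0.
case/eqP: v0; apply/matrixP=> i j; rewrite (ord1 j) mxE.
apply/eqP/negPn/negP=> vi.
have iS : i \in S by rewrite inE.
have := congr1 (fun M : 'cV_#|S| => M (enum_rank_in iS i) 0) u0.
by rewrite !mxE /f enum_rankK_in //; apply/eqP.
Qed.

End PMatrix.

(** * Positive vectors, leaves and symmetrizability of Cartan matrices *)

Section Cartan.
Variables (n : nat) (C : 'M[int]_n).
Hypothesis hC : finite_type_cartan C.

Lemma cartan_diag i : C i i = 2. Proof. by case: hC. Qed.
Lemma cartan_offdiag i j : i != j -> C i j <= 0. Proof. by case: hC => _ H *; apply: H. Qed.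
Lemma cartan_sym0 i j : (C i j == 0) = (C j i == 0). Proof. by case: hC. Qed.

(** The hypothesis only covers minors enumerated by [enum_val]. An injection differs from that
    enumeration by one permutation of rows and columns alike, so the two signs cancel. *)
Lemma cartan_minor k (f : 'I_k -> 'I_n) : injective f -> 0 < \det (mxsub f f C).
Proof.
case: k f => [|k] f finj; first by rewrite det_mx00.
pose S := [set f i | i : 'I_k.+1].
have cS : #|S| = k.+1 by rewrite card_imset // card_ord.
have fS i : f i \in S by apply: imset_f.
have S0 : S != set0 by apply/set0Pn; exists (f ord0).
have posS : 0 < \det (\matrix_(i < #|S|, j < #|S|) C (enum_val i) (enum_val j)).
  by case: hC => _ _ _ _; apply.
pose g (i : 'I_k.+1) : 'I_k.+1 := cast_ord cS (enum_rank_in (fS ord0) (f i)).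
have ginj : injective g.
  move=> i j /cast_ord_inj /(congr1 enum_val).
  by rewrite !enum_rankK_in //; apply: finj.
pose s := perm ginj.
suff -> : \det (mxsub f f C) =
  \det (\matrix_(i < #|S|, j < #|S|) C (enum_val i) (enum_val j)) by [].
pose M := \matrix_(i < k.+1, j < k.+1)
  C (enum_val (cast_ord (esym cS) i)) (enum_val (cast_ord (esym cS) j)).
(* Generalising the size to [q] allows the equation on [#|S|] to be eliminated, which removes the
   casts. *)
have detM q (e : #|S| = q) :
    \det (\matrix_(i < #|S|, j < #|S|) C (enum_val i) (enum_val j)) =
    \det (\matrix_(i < q, j < q)
      C (enum_val (cast_ord (esym e) i)) (enum_val (cast_ord (esym e) j))).
  case: q / e; congr (\det _).
  by apply/matrixP=> i j; rewrite !mxE !cast_ord_id.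
rewrite (detM _ cS) -/M.
have -> : mxsub f f C = row_perm s (col_perm s M).
  apply/matrixP=> i j; rewrite !mxE !permE /g !cast_ordK !enum_rankK_in //.
rewrite row_permE col_permE !det_mulmx !det_perm mulrCA.
by rewrite odd_permV -signr_addb addbb expr0 mulr1.
Qed.

Lemma cartan_sign (v : 'cV[int]_n) :
  (forall i, v i 0 * (C *m v) i 0 <= 0) -> v = 0.
Proof.
move=> H; pose q := map_mx (intr : int -> rat).
have : q _ _ v = 0.
  apply: (@principal_pos_sign _ _ (q _ _ C)) => [k f finj|i].
    rewrite -map_mxsub det_map_mx ltr0z; exact: cartan_minor.
  have -> : (q _ _ C *m q _ _ v) i 0 = ((C *m v) i 0)%:~R by rewrite -map_mxM mxE.
  by rewrite mxE -intrM lerz0.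
move=> E; apply/matrixP=> i j; have := congr1 (fun M : 'cV_n => M i j) E.
by rewrite !mxE => /eqP; rewrite intr_eq0 => /eqP.
Qed.

Lemma det_cartan_gt0 : 0 < \det C.
Proof.
suff -> : C = mxsub id id C by apply: cartan_minor.
by apply/matrixP=> x y; rewrite !mxE.
Qed.

(** The witness is [\adj C] applied to the all-ones vector, so that [C *m v] is constantly [\det C].
    Its negative part [w] vanishes by [cartan_sign], and a zero coordinate of [v] would make the
    same coordinate of [C *m v] nonpositive. *)
Lemma cartan_posvec : exists v : 'cV[int]_n,
  (forall i, 0 < v i 0) /\ (forall i, 0 < (C *m v) i 0).
Proof.
pose v : 'cV[int]_n := \adj C *m const_mx 1.
have Cv : C *m v = const_mx (\det C).
  rewrite mulmxA mul_mx_adj mul_scalar_mx; apply/matrixP=> i j; rewrite !mxE mulr1 //.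
have Cvi i : (C *m v) i 0 = \det C by rewrite Cv mxE.
exists v; split=> [|i]; last by rewrite Cvi det_cartan_gt0.
have v0 i : 0 <= v i 0.
  pose w : 'cV[int]_n := \col_i Num.max 0 (- v i 0).
  have w0 : w = 0.
    apply: cartan_sign => k.
    have [vk|vk] := lerP 0 (v k 0).
      by rewrite [w k 0]mxE max_l ?mul0r // oppr_le0.
    apply: mulr_ge0_le0; first by rewrite mxE le_max lexx.
    have wk : w k 0 = - v k 0 by rewrite mxE max_r // oppr_ge0 ltW.
    have vw : (C *m (v + w)) k 0 <= 0.
      rewrite mxE; apply: sumr_le0 => l _.
      have [<-|kl] := eqVneq k l; first by rewrite mxE wk subrr mulr0.
      by apply: mulr_le0_ge0; [exact: cartan_offdiag | rewrite !mxE -lerBlDl sub0r le_max lexx orbT].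
    by move: vw; rewrite mulmxDr mxE Cvi; apply: le_trans; rewrite lerDr ltW // det_cartan_gt0.
  have wE : w i 0 = Num.max 0 (- v i 0) by rewrite mxE.
  have : - v i 0 <= w i 0 by rewrite wE le_max lexx orbT.
  by rewrite w0 [leRHS]mxE oppr_le0.
move=> i; rewrite lt_neqAle v0 andbT; apply/eqP=> /esym vi.
have := Cvi i; rewrite mxE => E.
suff : \sum_j C i j * v j 0 <= 0 by rewrite E leNgt det_cartan_gt0.
apply: sumr_le0 => j _; have [->|ij] := eqVneq j i; first by rewrite vi mulr0.
by apply: mulr_le0_ge0 => //; apply: cartan_offdiag; rewrite eq_sym.
Qed.

Lemma cartan_lt0 i j : j != i -> C i j != 0 -> C i j < 0.
Proof. by move=> ji cij; rewrite lt_neqAle cij cartan_offdiag // eq_sym. Qed.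

(** The Dynkin diagram is a forest. If every vertex of [S] had two neighbours in [S], the indicator
    vector of [S] would contradict [cartan_sign]: each relevant coordinate of its image is at most 2
    - 1 - 1. *)
Lemma cartan_leaf (S : {set 'I_n}) : S != set0 ->
  exists2 i, i \in S & forall j k, j \in S -> k \in S -> j != i -> k != i ->
    C i j != 0 -> C i k != 0 -> j = k.
Proof.
move=> S0.
have [/exists_inP[i iS Hi]|] := boolP [exists i in S, [forall j in S, forall k in S,
   [&& j != i, k != i, C i j != 0 & C i k != 0] ==> (j == k)]].
  exists i => // j k jS kS ji ki cj ck.
  by apply/eqP; move: Hi => /forall_inP/(_ j jS)/forall_inP/(_ k kS)/implyP; apply; apply/and4P.
rewrite negb_exists => /forallP H.
pose v := \col_i (i \in S)%:R : 'cV[int]_n.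
suff v0 : v = 0.
  case/set0Pn: S0 => i iS; have := congr1 (fun M : 'cV_n => M i 0) v0.
  by rewrite !mxE iS.
apply: cartan_sign => i; rewrite [v i 0]mxE.
have [iS|] := boolP (i \in S); last by rewrite mul0r.
rewrite mul1r.
have := H i; rewrite iS /= negb_forall => /existsP[j]; rewrite negb_imply => /andP[jS].
rewrite negb_forall => /existsP[k]; rewrite !negb_imply => /and3P[kS /and4P[ji ki cj ck] jk].
rewrite mxE (bigD1 i) //= (bigD1 j) //= (bigD1 k) /=; last by rewrite ki eq_sym jk.
rewrite !mxE iS jS kS !mulr1 cartan_diag.
have cij := cartan_lt0 ji cj.
have cik := cartan_lt0 ki ck.
set T := \sum_(_ | _) _.
suff : T <= 0 by lia.
apply: sumr_le0 => l /andP[/andP[li _] _].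
by apply: mulr_le0_ge0; rewrite ?cartan_offdiag ?mxE // eq_sym.
Qed.

(** Remove a leaf [i], symmetrize the rest, then adjust the at most one edge that joins [i] to
    it. *)
Lemma cartan_symmetrizable : exists d : 'I_n -> int,
  (forall i, 0 < d i) /\ (forall i j, d i * C i j = d j * C j i).
Proof.
suff H k (S : {set 'I_n}) : #|S| = k -> exists d : 'I_n -> int,
    (forall i, 0 < d i) /\ (forall i j, i \in S -> j \in S -> d i * C i j = d j * C j i).
  have [d [d0 dS]] := H _ [set: 'I_n] erefl.
  by exists d; split=> // i j; apply: dS; rewrite inE.
elim: k S => [|k IHk] S cS.
  exists (fun _ => 1); split=> // i j.
  by rewrite (cards0_eq cS) inE.
have S0 : S != set0 by rewrite -card_gt0 cS.
have [i iS Hi] := cartan_leaf S0.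
have cS' : #|S :\ i| = k by apply: succn_inj; rewrite -cS (cardsD1 i S) iS.
have [d [d0 dS]] := IHk _ cS'.
have [/existsP[j /and3P[jS ji cij]]|] := boolP [exists j, [&& j \in S, j != i & C i j != 0]].
  have cij' := cartan_lt0 ji cij.
  have cji' : C j i < 0.
    by apply: cartan_lt0; [rewrite eq_sym | rewrite cartan_sym0].
  (* Multiplying all the other entries by [- C i j] balances the edge between [i] and [j] without
     leaving the integers. *)
  exists (fun k => if k == i then d j * - C j i else d k * - C i j); split=> [l|a b aS bS].
    by case: ifP => _; apply: mulr_gt0 => //; lia.
  have Hz l : l \in S -> l != i -> l != j -> C i l = 0 /\ C l i = 0.
    move=> lS li lj; suff z : C i l = 0 by split=> //; apply/eqP; rewrite cartan_sym0 z.
    by apply/eqP; apply: contraNT lj => cil; apply/eqP; apply: Hi.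
  have [->|ai] := eqVneq a i; have [->|bi] := eqVneq b i => //.
  - have [->|bj] := eqVneq b j; first by ring.
    by have [-> ->] := Hz b bS bi bj; rewrite !mulr0.
  - have [->|aj] := eqVneq a j; first by ring.
    by have [-> ->] := Hz a aS ai aj; rewrite !mulr0.
  rewrite -mulrA [- _ * _]mulrC mulrA dS ?inE ?ai ?bi //; ring.
rewrite negb_exists => /forallP Hz.
have {}Hz l : l \in S -> l != i -> C i l = 0 /\ C l i = 0.
  move=> lS li; have := Hz l; rewrite lS li /= negbK => /eqP z.
  by split=> //; apply/eqP; rewrite cartan_sym0 z.
exists d; split=> // a b aS bS.
have [->|ai] := eqVneq a i; have [->|bi] := eqVneq b i => //.
- by have [-> ->] := Hz b bS bi; rewrite !mulr0.
- by have [-> ->] := Hz a aS ai; rewrite !mulr0.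
by rewrite dS ?inE ?ai ?bi.
Qed.

End Cartan.

(** * The quadratic form on the root lattice *)

Section Form.
Variables (n : nat) (C : 'M[int]_n) (d : 'I_n -> int).
Hypothesis hC : finite_type_cartan C.
Hypothesis d_gt0 : forall i, 0 < d i.
Hypothesis d_sym : forall i j, d i * C i j = d j * C j i.

(** The Gram matrix of the simple roots, scaled so that the [i]-th one has squared norm [2 * d i];
    [bform] takes simple-root coordinates. *)
Definition gram : 'M[int]_n := \matrix_(i, j) (d i * C i j).
Definition bform (x y : 'cV[int]_n) : int := \sum_k \sum_l gram k l * (x k 0 * y l 0).

Lemma bformE x y : bform x y = (x^T *m gram *m y) 0 0.
Proof.
rewrite mxE; under [RHS]eq_bigr do rewrite mxE mulr_suml.
rewrite exchange_big; apply: eq_bigr => k _; apply: eq_bigr => l _.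
by rewrite [x^T _ _]mxE; ring.
Qed.

Lemma gram_sym k l : gram k l = gram l k.
Proof. by rewrite !mxE. Qed.

Lemma gram_diag k : gram k k = 2 * d k.
Proof. by rewrite mxE (cartan_diag hC) mulrC. Qed.

Lemma gram_offdiag k l : k != l -> gram k l <= 0.
Proof.
by move=> kl; rewrite mxE; apply: mulr_ge0_le0; [exact: ltW | exact: cartan_offdiag].
Qed.

Lemma bform_sym x y : bform x y = bform y x.
Proof.
rewrite /bform exchange_big; apply: eq_bigr => k _; apply: eq_bigr => l _.
by rewrite gram_sym [x _ _ * _]mulrC.
Qed.

Lemma bformDl x y z : bform (x + y) z = bform x z + bform y z.
Proof. by rewrite !bformE linearD !mulmxDl mxE. Qed.

(* With [v > 0] such that [C v > 0], the quadratic form is diagonally dominant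
   in the rescaled coordinates [x_k / v_k]. *)
Lemma bform_coord_bound : exists2 P : int, 0 < P &
  forall (x : 'cV[int]_n) k, x k 0 ^+ 2 <= P * bform x x.
Proof.
have [v [v0 Cv0]] := cartan_posvec hC.
pose P := \prod_k v k 0.
have P0 : 0 < P by apply: prodr_gt0.
exists (P ^+ 2); first exact: exprn_gt0.
move=> x k0.
(* [y k] below is [P * x_k / v_k], the rescaled coordinate with its denominator cleared. *)
pose u k := \prod_(j | j != k) v j 0.
have uP k : v k 0 * u k = P by rewrite /P (bigD1 k).
have u0 k : 0 < u k by apply: prodr_gt0.
pose A k l := gram k l * (v k 0 * v l 0).
pose y k := x k 0 * u k.
have Asym k l : A k l = A l k by rewrite /A gram_sym; ring.
have QE : P ^+ 2 * bform x x = \sum_k \sum_l A k l * (y k * y l).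
  rewrite mulr_sumr; apply: eq_bigr => k _; rewrite mulr_sumr; apply: eq_bigr => l _.
  by rewrite expr2 -{1}(uP k) -(uP l) /A /y; ring.
pose r k := \sum_l A k l.
have r1 k : 1 <= r k.
  have -> : r k = d k * v k 0 * (C *m v) k 0.
    rewrite mxE mulr_sumr; apply: eq_bigr => l _; rewrite /A mxE; ring.
  have := d_gt0 k; have := v0 k; have := Cv0 k; nia.
(* For [k != l] the coefficient [A k l] is nonpositive, so 2 y_k y_l may be replaced by the larger
   y_k^2 + y_l^2; the rows then sum to [r k]. *)
have H2 : 2 * \sum_k r k * y k ^+ 2 <= 2 * (P ^+ 2 * bform x x).
  rewrite QE.
  have -> : 2 * \sum_k r k * y k ^+ 2 = \sum_k \sum_l A k l * (y k ^+ 2 + y l ^+ 2).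
    have -> : 2 * \sum_k r k * y k ^+ 2 = \sum_k r k * y k ^+ 2 + \sum_k r k * y k ^+ 2 by ring.
    have -> : \sum_k \sum_l A k l * (y k ^+ 2 + y l ^+ 2) =
       \sum_k \sum_l A k l * y k ^+ 2 + \sum_k \sum_l A k l * y l ^+ 2.
      rewrite -big_split; apply: eq_bigr => k _; rewrite -big_split; apply: eq_bigr => l _.
      by rewrite /= mulrDr.
    congr (_ + _); first by apply: eq_bigr => k _; rewrite mulr_suml.
    rewrite exchange_big; apply: eq_bigr => k _; rewrite mulr_suml.
    by apply: eq_bigr => l _; rewrite Asym.
  rewrite mulr_sumr; apply: ler_sum => k _; rewrite mulr_sumr; apply: ler_sum => l _.
  have [->|kl] := eqVneq k l; first by rewrite le_eqVlt; apply/orP; left; apply/eqP; ring.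
  have Akl : A k l <= 0.
    by apply: mulr_le0_ge0; [exact: gram_offdiag | apply: mulr_ge0; exact: ltW].
  have := sqr_ge0 (y k - y l); rewrite !expr2; nia.
have yk : y k0 ^+ 2 <= \sum_k r k * y k ^+ 2.
  rewrite (bigD1 k0) //= -[leLHS]addr0; apply: lerD.
    exact: ler_peMl (sqr_ge0 _) (r1 _).
  by apply: sumr_ge0 => k _; apply: mulr_ge0; [have := r1 k; lia | exact: sqr_ge0].
have : x k0 0 ^+ 2 <= y k0 ^+ 2.
  rewrite /y exprMn; apply: ler_peMr (sqr_ge0 _) _.
  by rewrite exprn_ege1 //; have := u0 k0; lia.
move=> xy; apply: le_trans xy (le_trans yk _).
by rewrite -(ler_pM2l (_ : 0 < 2 :> int)).
Qed.

Lemma bform_gt0 x : x != 0 -> 0 < bform x x.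
Proof.
move=> x0; have [P P0 HP] := bform_coord_bound.
have /existsP[k xk] : [exists k, x k 0 != 0].
  apply: contraNT x0; rewrite negb_exists => /forallP H.
  apply/eqP/matrixP=> i j; rewrite (ord1 j) mxE; apply/eqP.
  by have := H i; rewrite negbK.
have := HP x k; have : 0 < x k 0 ^+ 2 by rewrite exprn_even_gt0.
by move=> a b; have := lt_le_trans a b; rewrite pmulr_rgt0.
Qed.

(* Off-diagonal terms of the quadratic form come in equal pairs, so on the
   lattice [{x | c divides d_k x_k}] its values are multiples of [2 c]. *)
Lemma bform_lattice (c : int) (x : 'cV[int]_n) : 0 < c -> (forall k, (c %| d k * x k ord0)%Z) ->
  x != 0 -> 2 * c <= bform x x.
Proof.
move=> c0 Hc x0.
pose f (k l : 'I_n) := gram k l * (x k 0 * x l 0).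
have fsym k l : f k l = f l k by rewrite /f gram_sym; ring.
have fdvd k l : (c %| f k l)%Z.
  rewrite /f mxE.
  have -> : d k * C k l * (x k 0 * x l 0) = d k * x k 0 * (C k l * x l 0) by ring.
  exact: dvdz_mulr.
have E : bform x x = \sum_k f k k + 2 * \sum_(k : 'I_n) \sum_(l : 'I_n | (k < l)%N) f k l.
  have -> : 2 * \sum_(k : 'I_n) \sum_(l : 'I_n | (k < l)%N) f k l =
     \sum_(k : 'I_n) \sum_(l : 'I_n | (k < l)%N) f k l + \sum_(k : 'I_n) \sum_(l : 'I_n | (l < k)%N) f k l.
    have -> : \sum_(k : 'I_n) \sum_(l : 'I_n | (l < k)%N) f k l = \sum_(k : 'I_n) \sum_(l : 'I_n | (k < l)%N) f k l.
      rewrite (exchange_big_dep predT) //=; apply: eq_bigr => k _.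
      by apply: eq_bigr => l _; rewrite fsym.
    ring.
  rewrite -!big_split /=; apply: eq_bigr => k _.
  rewrite (bigD1 k) //=; congr (_ + _).
  rewrite (bigID (fun l : 'I_n => (k < l)%N)) /=; congr (_ + _).
    apply: eq_bigl => l; rewrite -val_eqE /=; lia.
  apply: eq_bigl => l; rewrite -val_eqE /=; lia.
have /dvdzP[q qE] : (2 * c %| bform x x)%Z.
  rewrite E; apply: rpredD.
    apply: rpred_sum => k _; rewrite /f gram_diag.
    have -> : 2 * d k * (x k 0 * x k 0) = 2 * (d k * x k 0) * x k 0 by ring.
    by apply: dvdz_mulr; rewrite dvdz_mul2l ?Hc.
  rewrite dvdz_mul2l //; apply: rpred_sum => k _; apply: rpred_sum => l _; exact: fdvd.
have c2 : 0 < 2 * c by rewrite pmulr_rgt0.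
have := bform_gt0 x0; rewrite qE pmulr_lgt0 // gtz0_ge1 => q1.
exact: ler_peMl (ltW c2) q1.
Qed.

End Form.

(** * Lengths, roots and reflections *)

Section Coxeter.
Variables (n : nat) (C : 'M[int]_n).
Hypothesis hC : finite_type_cartan C.

Lemma scalemx_inj (p q : nat) (a : int) (A B : 'M[int]_(p, q)) :
  a != 0 -> a *: A = a *: B -> A = B.
Proof.
by move=> a0 /matrixP H; apply/matrixP=> i j; have := H i j; rewrite !mxE; apply: mulfI.
Qed.

Lemma cartan_mulI (m : nat) (A B : 'M[int]_(n, m)) : C *m A = C *m B -> A = B.
Proof.
move=> /(congr1 (mulmx (\adj C))); rewrite !mulmxA mul_adj_mx !mul_scalar_mx.
by apply: scalemx_inj; rewrite gt_eqF ?det_cartan_gt0.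
Qed.

Lemma cartan_Imul (m : nat) (A B : 'M[int]_(m, n)) : A *m C = B *m C -> A = B.
Proof.
move=> /(congr1 (mulmx^~ (\adj C))); rewrite -!mulmxA mul_mx_adj !mul_mx_scalar.
by apply: scalemx_inj; rewrite gt_eqF ?det_cartan_gt0.
Qed.

Lemma delta_mul_delta (A : 'M[int]_n) i : delta_mx i i *m A *m delta_mx i i = A i i *: delta_mx i i.
Proof.
apply/matrixP=> k l; rewrite !mxE (bigD1 i) //= [X in _ + X]big1 => [|j ji].
  rewrite addr0 !mxE (bigD1 i) //= big1 => [|j ji]; last by rewrite !mxE (negPf ji) andbF mul0r.
  by rewrite addr0 !mxE !eqxx andbT /=; do 2!case: (_ == i); rewrite ?mulr1 ?mulr0 ?mul1r ?mul0r.
by rewrite !mxE (negPf ji) mulr0.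
Qed.

Lemma delta_mul_col i (v : 'cV[int]_n) : delta_mx i i *m v = v i 0 *: delta_mx i 0.
Proof.
apply/matrixP=> k l; rewrite (ord1 l) mxE (bigD1 i) //= big1 => [|j ji].
  by rewrite !mxE !eqxx !andbT addr0 mulrC.
by rewrite mxE (negPf ji) andbF mul0r.
Qed.

Lemma mul_delta_mul (A B : 'M[int]_n) i k l :
  (A *m delta_mx i i *m B) k l = A k i * B i l.
Proof.
have -> : delta_mx i i = (delta_mx i 0 : 'cV[int]_n) *m (delta_mx 0 i : 'rV[int]_n).
  by apply/matrixP=> a c; rewrite !mxE big_ord1 !mxE !eqxx andbT /= -natrM mulnb.
rewrite mulmxA -colE -mulmxA -rowE mxE big_ord1.
by rewrite !mxE.
Qed.

Lemma sref_mul i : sref C i *m sref C i = 1%:M.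
Proof.
rewrite /sref mulmxBl mul1mx mulmxBr mulmx1 -mulmxA (mulmxA (delta_mx i i)).
rewrite delta_mul_delta (cartan_diag hC) -scalemxAr.
set X := C *m _; have -> : X - 2 *: X = - X by rewrite scaler_nat mulr2n opprD addrA subrr sub0r.
by rewrite opprK subrK.
Qed.

Lemma wordmx_cat s1 s2 : wordmx C (s1 ++ s2) = wordmx C s1 *m wordmx C s2.
Proof. by elim: s1 => [|i s IH] /=; rewrite ?mul1mx // IH mulmxA. Qed.

Lemma wordmx1 i : wordmx C [:: i] = sref C i.
Proof. exact: mulmx1. Qed.

Lemma wordmx_rcons s i : wordmx C (rcons s i) = wordmx C s *m sref C i.
Proof. by rewrite -cats1 wordmx_cat wordmx1. Qed.

Lemma wordmx_rev s : wordmx C s *m wordmx C (rev s) = 1%:M.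
Proof.
elim: s => [|i s IH]; first exact: mulmx1.
by rewrite rev_cons wordmx_rcons /= mulmxA -(mulmxA _ (wordmx C s)) IH mulmx1 sref_mul.
Qed.

Lemma inW_unit w : inW C w -> w \in unitmx.
Proof. by case=> s <-; have [] := mulmx1_unit (wordmx_rev s). Qed.

Lemma invmx_wordmx s : invmx (wordmx C s) = wordmx C (rev s).
Proof.
have u : wordmx C s \in unitmx by apply: inW_unit; exists s.
by rewrite -[LHS]mulmx1 -(wordmx_rev s) mulKmx.
Qed.

Lemma inW1 : inW C 1%:M. Proof. by exists [::]. Qed.
Lemma inW_sref i : inW C (sref C i). Proof. by exists [:: i]; rewrite wordmx1. Qed.
Lemma inW_word s : inW C (wordmx C s). Proof. by exists s. Qed.
Lemma inWM u v : inW C u -> inW C v -> inW C (u *m v).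
Proof. by move=> [s <-] [t <-]; exists (s ++ t); rewrite wordmx_cat. Qed.
Lemma inWV u : inW C u -> inW C (invmx u).
Proof. by move=> [s <-]; exists (rev s); rewrite invmx_wordmx. Qed.
Lemma invmxM u v : inW C u -> inW C v -> invmx (u *m v) = invmx v *m invmx u.
Proof.
move=> Wu Wv; have [uu uv] := (inW_unit Wu, inW_unit Wv).
have uuv := inW_unit (inWM Wu Wv).
by apply: (can_inj (mulKmx uuv)); rewrite mulmxV // mulmxA mulmxK // mulmxV.
Qed.
Lemma invmx_sref i : invmx (sref C i) = sref C i.
Proof. by rewrite -wordmx1 invmx_wordmx. Qed.
Hint Resolve inW1 inW_sref inW_word inWM inWV inW_unit : core.

Lemma srefK i (w : 'M[int]_n) : sref C i *m (sref C i *m w) = w.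
Proof. by rewrite mulmxA sref_mul mul1mx. Qed.
Lemma mul_srefK i (w : 'M[int]_n) : w *m sref C i *m sref C i = w.
Proof. by rewrite -mulmxA sref_mul mulmx1. Qed.

Definition reduced_word w s :=
  wordmx C s = w /\ forall s', wordmx C s' = w -> (size s <= size s')%N.

Lemma ex_reduced_word w : inW C w -> exists s, reduced_word w s.
Proof.
case=> s; have [k] := ubnP (size s); elim: k s => // k IHk s ks sw.
have [[s' [sw' ss']]|H] := classic (exists s', wordmx C s' = w /\ (size s' < size s)%N).
  by apply: (IHk s') => //; apply: leq_trans ss' _.
exists s; split=> // s' sw'; rewrite leqNgt; apply/negP => ss'.
by apply: H; exists s'.
Qed.

(** A chosen reduced word, meaningful only for elements of W. *)
Definition wd w := epsilon (inhabits [::]) (reduced_word w).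
Definition len w := size (wd w).

Lemma wdP w : inW C w -> reduced_word w (wd w).
Proof. by move=> Ww; apply: epsilon_spec; apply: ex_reduced_word. Qed.
Lemma wdK w : inW C w -> wordmx C (wd w) = w.
Proof. by case/wdP. Qed.
Lemma len_word s : (len (wordmx C s) <= size s)%N.
Proof. by have [_] := wdP (inW_word s); apply. Qed.

Lemma len_leP u v : inW C u -> inW C v -> len_le C u v <-> (len u <= len v)%N.
Proof.
move=> Wu Wv; split=> [[t [<- H]]|H].
  by apply: leq_trans (len_word t) (H _ _); apply: wdK.
exists (wd u); split=> [|s sv]; first exact: wdK.
by apply: leq_trans H _; rewrite -sv len_word.
Qed.

Lemma len_ltP u v : inW C u -> inW C v -> len_lt C u v <-> (len u < len v)%N.
Proof.
move=> Wu Wv; split=> [[t [<- H]]|H].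
  by apply: leq_ltn_trans (len_word t) (H _ _); apply: wdK.
exists (wd u); split=> [|s sv]; first exact: wdK.
by apply: leq_trans H _; rewrite -sv len_word.
Qed.

Lemma is_lengthP w : inW C w -> is_length C w (len w).
Proof.
move=> Ww; split; first by exists (wd w); rewrite wdK.
by move=> s <-; apply: len_word.
Qed.

Lemma len1 : len 1%:M = 0%N.
Proof. by apply/eqP; rewrite -leqn0; apply: (len_word [::]). Qed.

Lemma len_eq0 w : inW C w -> len w = 0%N -> w = 1%:M.
Proof. by move=> Ww /size0nil; rewrite -{2}(wdK Ww) => ->. Qed.

Lemma lenV w : inW C w -> len (invmx w) = len w.
Proof.
have H v : inW C v -> (len (invmx v) <= len v)%N.
  by move=> Wv; rewrite -{1}(wdK Wv) invmx_wordmx; apply: leq_trans (len_word _) _; rewrite size_rev.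
move=> Ww; apply/eqP; rewrite eqn_leq H //=.
by rewrite -{1}(invmxK w) H //; auto.
Qed.

(* The simple reflection [sref C i] in root coordinates. *)
Definition rref i : 'M[int]_n := 1%:M - delta_mx i i *m C.
Definition rword s : 'M[int]_n := foldr (fun i M => rref i *m M) 1%:M s.
(** Column [i] holds the simple-root coordinates of the root w(alpha_i). The chosen word does not
    matter: by [rtE] the injective matrix [C] intertwines [rt w] with [w]. *)
Definition rt w := rword (wd w).

Lemma rref_sref i : C *m rref i = sref C i *m C.
Proof. by rewrite mulmxBr mulmxBl mulmx1 mul1mx mulmxA. Qed.

Lemma rtE w : inW C w -> C *m rt w = w *m C.
Proof.
move=> Ww; rewrite -{2}(wdK Ww) /rt; elim: (wd w) => [|i s IH] /=.
  by rewrite mulmx1 mul1mx.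
by rewrite mulmxA rref_sref -mulmxA IH mulmxA.
Qed.

Lemma rtM u v : inW C u -> inW C v -> rt (u *m v) = rt u *m rt v.
Proof.
by move=> Wu Wv; apply: cartan_mulI; rewrite mulmxA !rtE //; auto; rewrite -!mulmxA rtE.
Qed.
Lemma rt_sref i : rt (sref C i) = rref i.
Proof. by apply: cartan_mulI; rewrite rtE // rref_sref. Qed.
Lemma rt1 : rt 1%:M = 1%:M.
Proof. by apply: cartan_mulI; rewrite rtE // mulmx1 mul1mx. Qed.
Lemma rtV w : inW C w -> rt (invmx w) *m rt w = 1%:M.
Proof. by move=> Ww; rewrite -rtM; auto; rewrite mulVmx ?rt1 // inW_unit. Qed.
Lemma rt_inj u v : inW C u -> inW C v -> rt u = rt v -> u = v.
Proof. by move=> Wu Wv E; apply: cartan_Imul; rewrite -!rtE // E. Qed.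

Lemma rref_mulE i (m : nat) (M : 'M[int]_(n, m)) k l :
  (rref i *m M) k l = M k l - (k == i)%:R * \sum_j C i j * M j l.
Proof.
rewrite /rref mulmxBl mul1mx -mulmxA mxE [X in _ + X]mxE; congr (_ - _).
rewrite mxE (bigD1 i) //= big1 ?addr0 => [|j ji]; last by rewrite [delta_mx _ _ _ _]mxE (negPf ji) andbF mul0r.
by rewrite [delta_mx _ _ _ _]mxE eqxx andbT [(C *m M) _ _]mxE.
Qed.

(** * Invariance of the form and integrality of coroots *)

Section Gram.
Variable d : 'I_n -> int.
Hypothesis d_gt0 : forall i, 0 < d i.
Hypothesis d_sym : forall i j, d i * C i j = d j * C j i.

Lemma gram_rword s : (rword s)^T *m gram C d *m rword s = gram C d.
Proof.
elim: s => [|i s IH] /=; first by rewrite trmx1 mul1mx mulmx1.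
rewrite trmx_mul -!mulmxA (mulmxA (rref i)^T) (mulmxA (_ *m _) (rref i)).
suff -> : (rref i)^T *m gram C d *m rref i = gram C d by rewrite mulmxA.
have -> : (rref i)^T = 1%:M - C^T *m delta_mx i i.
  by rewrite /rref [LHS]linearB /= trmx1 trmx_mul trmx_delta.
rewrite /rref mulmxBl mul1mx !mulmxBr !mulmx1.
rewrite -[RHS]subr0 -!addrA; congr (_ + _); rewrite -opprD; congr (- _).
apply/matrixP=> k l.
have E1 : (gram C d *m (delta_mx i i *m C)) k l = gram C d k i * C i l.
  by rewrite mulmxA mul_delta_mul.
have E2 (M : 'M[int]_n) : (C^T *m delta_mx i i *m M) k l = C i k * M i l.
  by rewrite mul_delta_mul mxE.
have E3 : (gram C d *m (delta_mx i i *m C)) i l = 2 * d i * C i l.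
  by rewrite mulmxA mul_delta_mul gram_diag.
rewrite mulmxBl -(mulmxA _ (gram C d)) mxE [X in _ + X]mxE [X in _ + (_ + X)]mxE.
by rewrite !E2 E1 E3 !mxE (d_sym k i); ring.
Qed.

Lemma bform_rt w i j : bform C d (col i (rt w)) (col j (rt w)) = gram C d i j.
Proof.
rewrite bformE !colE trmx_mul !mulmxA -(mulmxA _ (rt w)^T) -(mulmxA _ _ (rt w)).
rewrite gram_rword trmx_delta -rowE.
by rewrite -colE !mxE.
Qed.

(** The quotients are the coordinates of the coroot of a root in the orbit of alpha_i. Symmetry of
    [d k * C k l] keeps them integral under each simple reflection. *)
Lemma rword_dvd s k i : (d i %| d k * rword s k i)%Z.
Proof.
elim: s k => [|j s IH] k /=.
  by rewrite mxE; case: eqVneq => [->|_]; rewrite ?mulr1 ?mulr0 // dvdz0.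
rewrite rref_mulE mulrBr; apply: rpredB; first exact: IH.
have [->|_] := eqVneq k j; last by rewrite mul0r mulr0 dvdz0.
rewrite mul1r mulr_sumr; apply: rpred_sum => l _.
by rewrite mulrA d_sym mulrAC; apply: dvdz_mulr.
Qed.

Lemma bform_invariant w (x : 'cV[int]_n) : bform C d (rt w *m x) (rt w *m x) = bform C d x x.
Proof.
rewrite !bformE trmx_mul !mulmxA -(mulmxA _ (rt w)^T) -(mulmxA _ _ (rt w)).
by rewrite gram_rword.
Qed.

End Gram.

(** Positivity of the root w(alpha_i); by [len_mul_sref] this says that [i] is a right ascent of
    [w]. *)
Definition posr w i := [forall k, 0 <= rt w k i].

(* Split a root [b] of squared norm [2 d_i] as [b+ - b-]; both parts lie in the
   lattice of bform_lattice, and their mutual product is nonpositive, so two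
   nonzero parts would give squared norm at least [4 d_i]. *)
Lemma root_sign w i : inW C w -> ~~ posr w i -> forall k, rt w k i <= 0.
Proof.
move=> Ww; rewrite negb_forall => /existsP[k0 neg0] k1; rewrite leNgt; apply/negP=> pos1.
have [d [d0 ds]] := cartan_symmetrizable hC.
have [b bk] : exists b : 'cV[int]_n, b = col i (rt w) by eexists.
have bk0 k : b k 0 = rt w k i by rewrite bk mxE.
pose bp : 'cV[int]_n := \col_k (if 0 <= b k 0 then b k 0 else 0).
pose bn : 'cV[int]_n := \col_k (if 0 <= b k 0 then 0 else - b k 0).
have bE : b = bp - bn.
  apply/matrixP=> k j; rewrite (ord1 j) [RHS]mxE [bp _ _]mxE [X in _ + X]mxE [bn _ _]mxE.
  by case: ifP => _; rewrite ?subr0 // sub0r opprK.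
have bpE k : bp k 0 = if 0 <= rt w k i then rt w k i else 0 by rewrite mxE bk0.
have bnE k : bn k 0 = if 0 <= rt w k i then 0 else - rt w k i by rewrite mxE bk0.
have bp0 : bp != 0.
  apply: contraTneq pos1 => /(congr1 (fun M : 'cV_n => M k1 0)).
  rewrite bpE mxE; case: (lerP 0 (rt w k1 i)) => [_ ->|H _]; first by rewrite ltxx.
  by rewrite -leNgt ltW.
have bn0 : bn != 0.
  apply: contraNneq neg0 => /(congr1 (fun M : 'cV_n => M k0 0)).
  by rewrite bnE mxE; case: (lerP 0 (rt w k0 i)) => [//|H /eqP]; rewrite oppr_eq0 => /eqP E; rewrite E ltxx in H.
have dv k : (d i %| d k * b k ord0)%Z by rewrite bk0; apply: rword_dvd.
have Hp : 2 * d i <= bform C d bp bp.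
  apply: bform_lattice => // k; rewrite mxE; case: ifP => _; rewrite ?mulr0 ?dvdz0 //; exact: dv.
have Hn : 2 * d i <= bform C d bn bn.
  apply: bform_lattice => // k; rewrite mxE; case: ifP => _; rewrite ?mulr0 ?dvdz0 // mulrN; have := dv k; rewrite !dvdzE abszN; apply.
have Hx : bform C d bp bn <= 0.
  apply: sumr_le0 => k _; apply: sumr_le0 => l _.
  have [->|kl] := eqVneq k l.
    by rewrite [bp _ _]mxE [bn _ _]mxE; case: ifP => _; rewrite ?mul0r !mulr0.
  apply: mulr_le0_ge0; first exact: gram_offdiag.
  apply: mulr_ge0; first by rewrite bpE; case: ifP.
  by rewrite bnE; case: (lerP 0 (rt w l i)) => // H; rewrite oppr_ge0 ltW.
have := bform_rt ds w i i; rewrite gram_diag // -bk {1 2}bE.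
have sc x y : bform C d x ((-1) *: y) = - bform C d x y.
  by rewrite !bformE -scalemxAr mxE mulN1r.
have sc' x y : bform C d ((-1) *: x) y = - bform C d x y.
  by rewrite bform_sym // sc bform_sym.
rewrite -[- bn]scaleN1r bformDl [bform _ _ bp _]bform_sym // [bform _ _ (_ *: bn) (_ + _)]bform_sym //.
rewrite !bformDl !sc !sc' opprK (bform_sym ds bn bp).
have := d0 i; lia.
Qed.

Lemma unit_int (a b : int) : a * b = 1 -> b = 1 \/ b = -1.
Proof.
move=> /(congr1 absz); rewrite abszM => /eqP; rewrite muln_eq1 => /andP[_ /eqP]; lia.
Qed.

(** Column [j] of [rt z] has a single possibly nonzero entry, and the inverse matrix is integral
    too, so that entry is a unit. *)
Lemma root_unit z i j : inW C z -> (forall k, k != i -> rt z k j = 0) ->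
  rt z i j = 1 \/ rt z i j = -1.
Proof.
move=> Wz H; apply: (@unit_int (rt (invmx z) j i)).
have := congr1 (fun M : 'M_n => M j j) (rtV Wz).
rewrite !mxE eqxx (bigD1 i) //= big1 ?addr0 // => k ki.
by rewrite H ?mulr0.
Qed.

Lemma root_neq0 w i : inW C w -> exists k, rt w k i != 0.
Proof.
move=> Ww; have [/existsP//|] := boolP [exists k, rt w k i != 0].
rewrite negb_exists => /forallP H.
have := congr1 (fun M : 'M_n => M i i) (rtV Ww).
rewrite !mxE eqxx big1 // => k _.
by have := H k; rewrite negbK => /eqP->; rewrite mulr0.
Qed.

(** Here z(alpha_j) is plus or minus alpha_i. Invariance of the form gives [d i = d j], hence [z]
    carries row [i] of [C] to the same sign times row [j], and the two signs cancel in the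
    reflection. *)
Lemma simple_root_conj z i j : inW C z -> (forall k, k != i -> rt z k j = 0) ->
  z *m sref C j = sref C i *m z.
Proof.
move=> Wz H; have := root_unit Wz H; set b := rt z i j => bE.
have bb : b * b = 1 by case: bE => ->.
have [d [d0 ds]] := cartan_symmetrizable hC.
have colz : col j (rt z) = b *: delta_mx i 0.
  apply/matrixP=> k l; rewrite !mxE (ord1 l) eqxx andbT.
  by case: eqVneq => [->|/H->]; rewrite ?mulr1 ?mulr0.
have Gz : (rt z)^T *m gram C d *m rt z = gram C d by apply: gram_rword.
have dij : d i = d j.
  have := bform_rt ds z j j; rewrite colz bformE.
  have -> : (b *: delta_mx i 0 : 'cV[int]_n)^T = b *: delta_mx 0 i.
    by rewrite [LHS]linearZ /= trmx_delta.
  rewrite -!scalemxAl -scalemxAr scalerA bb scale1r -rowE -colE !mxE !(cartan_diag hC).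
  by rewrite ![_ * 2]mulrC; apply: mulfI.
have rowz : row i C *m rt z = b *: row j C.
  apply: (@scalemx_inj _ _ (d i)); first by rewrite gt_eqF.
  have rg l : d l *: row l C = (delta_mx l 0)^T *m gram C d.
    by rewrite trmx_delta -rowE; apply/matrixP=> x y; rewrite !mxE.
  rewrite scalemxAl rg scalerA mulrC dij -scalerA rg.
  have tr : (b *: delta_mx i 0 : 'cV[int]_n)^T = b *: (delta_mx i 0)^T by rewrite [LHS]linearZ.
  by rewrite -[in RHS]Gz !mulmxA -trmx_mul -colE colz tr -!scalemxAl scalerA bb scale1r.
apply: rt_inj; auto; rewrite !rtM; auto; rewrite !rt_sref /rref mulmxBr mulmxBl mulmx1 mul1mx.
congr (_ - _); apply/matrixP=> k l; rewrite mulmxA mul_delta_mul -mulmxA -[delta_mx i i]mul1mx.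
rewrite mul_delta_mul mxE.
have -> : (C *m rt z) i l = b * C j l.
  by have := congr1 (fun M : 'rV_n => M 0 l) rowz; rewrite -row_mul !mxE.
have [->|ki] := eqVneq k i; first by rewrite mul1r.
by rewrite H // !mul0r.
Qed.

Lemma rt_mul_sref w i k : inW C w -> rt (w *m sref C i) k i = - rt w k i.
Proof.
move=> Ww; rewrite rtM // rt_sref /rref mulmxBr mulmx1 mxE [X in _ + X]mxE.
rewrite mulmxA mul_delta_mul (cartan_diag hC); ring.
Qed.

Lemma posr_mul_sref w i : inW C w -> posr (w *m sref C i) i = ~~ posr w i.
Proof.
move=> Ww; apply/idP/idP => [/forallP P|N].
  apply/negP=> /forallP Q; have [k] := root_neq0 i Ww.
  by have := P k; rewrite rt_mul_sref // oppr_ge0 => L; rewrite eq_le L Q.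
by apply/forallP=> k; rewrite rt_mul_sref // oppr_ge0 root_sign.
Qed.

Lemma posr1 i : posr 1%:M i.
Proof. by apply/forallP=> k; rewrite rt1 mxE; case: eqP. Qed.

(** The reflection s_j alters only coordinate [j], so a positive root that it makes negative has no
    other nonzero coordinate, and [simple_root_conj] applies. *)
Lemma posr_sref_mul x i j : inW C x -> posr x i -> ~~ posr (sref C j *m x) i ->
  sref C j *m x = x *m sref C i.
Proof.
move=> Wx /forallP P N; symmetry; apply: simple_root_conj => // k kj.
have := root_sign (inWM (inW_sref j) Wx) N k.
rewrite rtM // rt_sref rref_mulE (negPf kj) mul0r subr0 => L.
by apply/eqP; rewrite eq_le L P.
Qed.

(** * Reflections, exchange and length *)

Definition rfl x i := x *m sref C i *m invmx x.

Lemma inW_rfl x i : inW C x -> inW C (rfl x i).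
Proof. by move=> Wx; apply: inWM; [apply: inWM | apply: inWV]. Qed.
Lemma rfl_mul x i : inW C x -> rfl x i *m x = x *m sref C i.
Proof. by move=> Wx; rewrite /rfl mulmxKV // inW_unit. Qed.
Lemma rfl_rfl x i : inW C x -> rfl x i *m rfl x i = 1%:M.
Proof.
by move=> Wx; rewrite {2}/rfl !mulmxA rfl_mul // mul_srefK mulmxV // inW_unit.
Qed.
Lemma rfl_mul_sref x i : inW C x -> rfl (x *m sref C i) i = rfl x i.
Proof. by move=> Wx; rewrite /rfl mul_srefK invmxM // invmx_sref mulmxA. Qed.
Lemma rfl_conj x y i : inW C x -> inW C y -> y *m rfl x i *m invmx y = rfl (y *m x) i.
Proof. by move=> Wx Wy; rewrite /rfl invmxM // !mulmxA. Qed.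

(** Replacing [x] by [x *m sref C i] negates the root and keeps the reflection, so the root may be
    taken positive. *)
Lemma reflectionP t :
  reflection C t <-> exists x i, [/\ inW C x, posr x i & t = rfl x i].
Proof.
split=> [[s [i ->]]|[x [i [Wx _ ->]]]]; last first.
  by exists (wd x), i; rewrite -invmx_wordmx wdK.
rewrite -invmx_wordmx -/(rfl (wordmx C s) i).
case P: (posr (wordmx C s) i); first by exists (wordmx C s), i.
exists (wordmx C s *m sref C i), i; rewrite posr_mul_sref // P rfl_mul_sref //.
by split; auto.
Qed.

Lemma inW_reflection t : reflection C t -> inW C t.
Proof. by case/reflectionP=> x [i [Wx _ ->]]; apply: inW_rfl. Qed.
Lemma reflection_mul t : reflection C t -> t *m t = 1%:M.
Proof. by case/reflectionP=> x [i [Wx _ ->]]; apply: rfl_rfl. Qed.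
Lemma reflection_conj t y : inW C y -> reflection C t -> reflection C (y *m t *m invmx y).
Proof.
move=> Wy [s [i ->]]; rewrite -invmx_wordmx -/(rfl (wordmx C s) i) rfl_conj //.
rewrite -(wdK Wy) -wordmx_cat; exists (wd y ++ s), i.
by rewrite -invmx_wordmx.
Qed.

(** The strong exchange condition: reading the word from the right, delete the first letter at which
    the positive root x(alpha_i) becomes negative. *)
Lemma exchange s x i : inW C x -> posr x i -> ~~ posr (wordmx C s *m x) i ->
  exists s', [/\ subseq s' s, size s = (size s').+1 & wordmx C s' = wordmx C s *m rfl x i].
Proof.
move=> Wx P; elim: s => [|j s IH] /=; first by rewrite mul1mx P.
case Q: (posr (wordmx C s *m x) i) => N; last first.
  have [s' [sub ss' E]] := IH (negbT Q); exists (j :: s').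
  by rewrite /= eqxx ss' E mulmxA.
exists s; split=> //; first exact: subseq_cons.
have Wsx : inW C (wordmx C s *m x) by apply: inWM.
rewrite -mulmxA in N.
have := posr_sref_mul Wsx Q N.
rewrite -mulmxA /rfl !mulmxA => E.
rewrite -[sref C j *m _ *m x]mulmxA (mulmxA _ _ x) E.
by rewrite mul_srefK mulmxK // inW_unit.
Qed.

Lemma len_mul_rfl_lt w x i : inW C w -> inW C x -> posr x i -> ~~ posr (w *m x) i ->
  (len (w *m rfl x i) < len w)%N.
Proof.
move=> Ww Wx P N; rewrite -{1}(wdK Ww) in N.
have [s' [_ ss' E]] := exchange Wx P N.
by rewrite -{1}(wdK Ww) -E; apply: leq_ltn_trans (len_word s') _; rewrite /len ss'.
Qed.

(** A negative image shortens [w] by [exchange]; for a positive one, the same argument is applied to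
    the product of [w] with the reflection. *)
Lemma len_mul_rfl w x i : inW C w -> inW C x -> posr x i ->
  (len w < len (w *m rfl x i))%N = posr (w *m x) i.
Proof.
move=> Ww Wx P; case Q: (posr (w *m x) i); last first.
  by apply/negbTE; rewrite -leqNgt ltnW // len_mul_rfl_lt // Q.
have Wt := inW_rfl i Wx.
have N : ~~ posr (w *m rfl x i *m x) i.
  by rewrite -mulmxA rfl_mul // mulmxA posr_mul_sref ?Q //; apply: inWM.
by have := len_mul_rfl_lt (inWM Ww Wt) Wx P N; rewrite -mulmxA rfl_rfl // mulmx1.
Qed.

Lemma rfl1 i : rfl 1%:M i = sref C i.
Proof. by rewrite /rfl mul1mx invmx1 mulmx1. Qed.

Lemma len_mul_sref_le w i : inW C w -> (len (w *m sref C i) <= (len w).+1)%N.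
Proof.
move=> Ww; rewrite -{1}(wdK Ww) -wordmx_rcons.
by apply: leq_trans (len_word _) _; rewrite size_rcons.
Qed.

Lemma len_mul_sref w i : inW C w ->
  if posr w i then len (w *m sref C i) = (len w).+1 else len w = (len (w *m sref C i)).+1.
Proof.
move=> Ww; have Ws := inWM Ww (inW_sref i).
have H := len_mul_rfl Ww inW1 (posr1 i); rewrite rfl1 mulmx1 in H.
have H' := len_mul_rfl Ws inW1 (posr1 i).
rewrite rfl1 mulmx1 mul_srefK posr_mul_sref // in H'.
have L := len_mul_sref_le i Ww.
have L' := len_mul_sref_le i Ws; rewrite mul_srefK in L'.
by case: (posr w i) H H' => /=; lia.
Qed.

(** Proportional roots have the same reflection: y^-1 x sends alpha_i to a multiple of alpha_j, so
    it conjugates s_i into s_j. *)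
Lemma rfl_root_eq x y i j (a b : int) : inW C x -> inW C y -> a != 0 ->
  (forall k, a * rt x k i = b * rt y k j) -> rfl x i = rfl y j.
Proof.
move=> Wx Wy a0 H; pose z := invmx y *m x.
have Wz : inW C z by apply: inWM => //; apply: inWV.
have zE k : a * rt z k i = b * (k == j)%:R.
  have <- : (rt (invmx y) *m rt y) k j = (k == j)%:R by rewrite rtV // mxE.
  rewrite rtM; auto; rewrite !mxE !mulr_sumr; apply: eq_bigr => l _.
  by rewrite mulrCA H mulrCA.
have : z *m sref C i = sref C j *m z.
  apply: simple_root_conj => // k /negPf kj; have := zE k.
  by rewrite kj mulr0 => /eqP; rewrite mulf_eq0 (negPf a0) => /eqP.
rewrite /z => /(congr1 (mulmx y)) /(congr1 (mulmx^~ (invmx x))).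
rewrite !mulmxA mulmxV ?inW_unit // mul1mx => E.
by rewrite /rfl E mulmxK ?inW_unit.
Qed.

Lemma rfl_weight x i (lam : 'cV[int]_n) : inW C x ->
  rfl x i *m lam = lam - (invmx x *m lam) i 0 *: (C *m col i (rt x)).
Proof.
move=> Wx; rewrite /rfl /sref mulmxBr mulmx1 mulmxBl mulmxV ?inW_unit // mulmxBl mul1mx.
congr (_ - _); rewrite -!mulmxA delta_mul_col -!scalemxAr; congr (_ *: _).
by rewrite colE !mulmxA rtE.
Qed.

(** By [rfl_weight], lam - t lam is a multiple of the root of t; when nonzero it determines the root
    up to scale, hence t. *)
Lemma reflection_weight_eq t1 t2 (lam : 'cV[int]_n) :
  reflection C t1 -> reflection C t2 -> t1 *m lam = t2 *m lam -> t1 *m lam <> lam -> t1 = t2.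
Proof.
move=> /reflectionP[x [i [Wx _ ->]]] /reflectionP[y [j [Wy _ ->]]].
rewrite !rfl_weight //; set a := (_ *m _) i 0; set b := (_ *m _) j 0 => E ne.
apply: (@rfl_root_eq _ _ _ _ a b) => // [|k].
  by apply: contra_notN ne => /eqP->; rewrite scale0r subr0.
have {}E : a *: col i (rt x) = b *: col j (rt y).
  apply: cartan_mulI; rewrite -!scalemxAr; apply: oppr_inj.
  by apply: (addrI lam).
by have := congr1 (fun M : 'cV_n => M k 0) E; rewrite !mxE.
Qed.

(** * Dominant weights: stabilisers and a bound on lengths *)

Lemma len_wordmx_prefix s i : len (wordmx C (rcons s i)) = size (rcons s i) ->
  len (wordmx C s) = size s /\ posr (wordmx C s) i.
Proof.
rewrite wordmx_rcons size_rcons => E.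
have := len_mul_sref i (inW_word s); have := len_word s; case: ifP => _; rewrite E; last by lia.
by move=> _ [->].
Qed.

(** Each letter [i] of a reduced word adds [lam i 0] times a positive root, whose coordinate sum is
    at least 1. *)
Lemma dominant_sub_word s (lam : 'cV[int]_n) : (forall i, 0 <= lam i 0) ->
  len (wordmx C s) = size s ->
  exists y : 'cV[int]_n, [/\ forall k, 0 <= y k 0, lam - wordmx C s *m lam = C *m y &
    \sum_(i <- s) lam i 0 <= \sum_k y k 0].
Proof.
move=> lam0; elim/last_ind: s => [_|s i IH E].
  exists 0; split=> [k||]; first by rewrite mxE.
    by rewrite mul1mx subrr mulmx0.
  by rewrite big_nil big1 // => k _; rewrite mxE.
have [E' P] := len_wordmx_prefix E.
have [y [y0 yE yS]] := IH E'.
have rt0 k : 0 <= rt (wordmx C s) k i by move/forallP: P.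
exists (y + lam i 0 *: col i (rt (wordmx C s))); split=> [k||].
- by rewrite !mxE addr_ge0 // mulr_ge0.
- rewrite wordmx_rcons [in RHS]mulmxDr -yE /sref mulmxBr mulmx1 mulmxBl opprD opprK addrA.
  congr (_ + _); rewrite -!mulmxA delta_mul_col colE -!scalemxAr; congr (_ *: _).
  by rewrite !mulmxA rtE.
rewrite big_rcons /=.
have [k0 nz] := root_neq0 i (inW_word s).
have H : 1 <= \sum_k rt (wordmx C s) k i.
  rewrite (bigD1 k0) //= -[leLHS]addr0; apply: lerD; last by apply: sumr_ge0.
  by rewrite -gtz0_ge1 lt_neqAle eq_sym nz rt0.
have -> : \sum_k (y + lam i 0 *: col i (rt (wordmx C s))) k 0 =
   \sum_k y k 0 + lam i 0 * \sum_k rt (wordmx C s) k i.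
  by rewrite mulr_sumr -big_split; apply: eq_bigr => k _; rewrite !mxE.
by apply: lerD => //; exact: ler_peMr (lam0 i) H.
Qed.

(** If [x] fixes [lam], the bound of [dominant_sub_word] forces [lam] to vanish at every letter of a
    reduced word. *)
Lemma dominant_stab x (lam : 'cV[int]_n) : inW C x -> (forall i, 0 <= lam i 0) ->
  x *m lam = lam -> inWJ C [set i | lam i 0 == 0] x.
Proof.
move=> Wx lam0 xl; exists (wd x); split; last exact: wdK.
have [|y [y0 yE yS]] := dominant_sub_word (s := wd x) lam0; first by rewrite wdK.
rewrite wdK // xl subrr in yE.
have y00 : y = 0 by apply: cartan_mulI; rewrite mulmx0.
have S0 : \sum_(i <- wd x) lam i 0 = 0.
  apply/eqP; rewrite eq_le sumr_ge0 ?andbT //; apply: le_trans yS _.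
  by rewrite y00 big1 // => k _; rewrite mxE.
apply/allP=> i ix; rewrite inE; apply/eqP.
move: S0; rewrite (big_rem i) //= => S0.
apply/eqP; rewrite eq_le lam0 andbT -S0 lerDl; exact: sumr_ge0.
Qed.

(** Take the weight [C *m v] with all coordinates at least 1. Then the length is at most the
    coordinate sum of v - w v, and this is bounded because the form controls coordinates and is
    invariant under [w]. *)
Lemma len_bounded : exists N, forall w, inW C w -> (len w <= N)%N.
Proof.
have [d [d0 ds]] := cartan_symmetrizable hC.
have [v [v0 Cv0]] := cartan_posvec hC.
have [P P0 HP] := bform_coord_bound hC d0 ds.
pose K := P * bform C d v v.
pose S : int := \sum_(k < n) (v k 0 + K).
exists `|S|%N => w Ww.
have [||y [y0 yE yS]] := dominant_sub_word (s := wd w) (lam := C *m v).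
- by move=> i; apply: ltW.
- by rewrite wdK.
have yE' : y = v - rt w *m v.
  apply: cartan_mulI; rewrite -yE wdK // mulmxBr; congr (_ - _).
  by rewrite !mulmxA rtE.
have yK k : y k 0 <= v k 0 + K.
  rewrite yE' mxE lerD2l mxE.
  have := HP (rt w *m v) k; rewrite bform_invariant // -/K.
  set a := (_ *m _) k 0; nia.
have L : (len w)%:Z <= \sum_(i <- wd w) (C *m v) i 0.
  rewrite /len; elim: (wd w) => [|i s IH]; first by rewrite big_nil.
  by rewrite big_cons /= -addn1 PoszD addrC; apply: lerD => //; have := Cv0 i; rewrite gtz0_ge1.
have : (len w)%:Z <= S.
  by apply: le_trans L (le_trans yS _); apply: ler_sum => k _.
lia.
Qed.

End Coxeter.

(** * Bruhat order *)

Section Bruhat.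
Variables (n : nat) (C : 'M[int]_n).
Hypothesis hC : finite_type_cartan C.
Local Notation s := (sref C).
Local Notation W := (inW C).
Local Notation "u ≤ v" := (bruhat C u v) (at level 70, no associativity).
Local Notation len := (len C).
Local Notation posr := (posr C).
Hint Resolve inW1 inW_sref inW_word inWM inWV : core.

Lemma bruhat_inWl u v : u ≤ v -> W u. Proof. by case. Qed.
Lemma bruhat_step_inWr u v : bruhat_step C u v -> W v.
Proof. by case=> Wu [t [/(inW_reflection hC) Wt -> _]]; auto. Qed.
Lemma bruhat_inWr u v : u ≤ v -> W v.
Proof.
case=> Wu /(clos_rt_rtn1 _ _ _ _) H; elim: H => // y z /bruhat_step_inWr.
by [].
Qed.
Lemma bruhat_refl u : W u -> u ≤ u.
Proof. by move=> Wu; split=> //; apply: rt_refl. Qed.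
Lemma bruhat_trans v u w : u ≤ v -> v ≤ w -> u ≤ w.
Proof. by move=> [Wu uv] [_ vw]; split=> //; apply: rt_trans uv vw. Qed.
Lemma bruhat_stepW u v : bruhat_step C u v -> u ≤ v.
Proof. by move=> H; split; [case: H | apply: rt_step]. Qed.

Lemma bruhat_indl v (P : 'M[int]_n -> Prop) : P v ->
  (forall u x, bruhat_step C u x -> x ≤ v -> P x -> P u) -> forall u, u ≤ v -> P u.
Proof.
move=> Pv H u uv; have Wv := bruhat_inWr uv; case: uv => Wu /(clos_rt_rt1n _ _ _ _) uv.
elim: uv Pv H Wv Wu => // {}u x {}v ux xv IH Pv H Wv Wu.
have Wx := bruhat_step_inWr ux.
by apply: (H u x) => //; [split=> //; apply: clos_rt1n_rt | apply: IH].
Qed.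

Lemma bruhat_indr u (P : 'M[int]_n -> Prop) : P u ->
  (forall x v, u ≤ x -> bruhat_step C x v -> P x -> P v) -> forall v, u ≤ v -> P v.
Proof.
move=> Pu H v [Wu /(clos_rt_rtn1 _ _ _ _) uv].
elim: uv => // y z yz uy Py.
by apply: (H y z) => //; split=> //; apply: clos_rtn1_rt.
Qed.

Lemma bruhat_step_len u v : bruhat_step C u v -> (len u < len v)%N.
Proof.
by move=> H; have Wv := bruhat_step_inWr H; case: H => Wu [t [_ E]]; rewrite len_ltP.
Qed.

Lemma bruhat_len u v : u ≤ v -> (len u <= len v)%N.
Proof.
move: u; apply: bruhat_indl => // u x /bruhat_step_len ux _ xv.
by apply: leq_trans xv; apply: ltnW.
Qed.

Lemma bruhat_len_eq u v : u ≤ v -> (len v <= len u)%N -> u = v.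
Proof.
move=> uv; have : u = v \/ (len u < len v)%N.
  move: u uv; apply: bruhat_indl; first by left.
  move=> u x /bruhat_step_len ux /bruhat_len xv _; right; exact: leq_trans ux xv.
by case=> // lt le; rewrite leqNgt lt in le.
Qed.

Lemma bruhat_antisym u v : u ≤ v -> v ≤ u -> u = v.
Proof. by move=> uv /bruhat_len; apply: bruhat_len_eq. Qed.

Lemma bruhat_cover u v : u ≤ v -> len v = (len u).+1 ->
  exists2 t, reflection C t & v = u *m t.
Proof.
move=> uv; have : u = v \/ exists2 x, bruhat_step C u x & x ≤ v.
  move: u uv; apply: bruhat_indl; first by left.
  by move=> u x ux xv _; right; exists x.
case=> [->|[x ux xv] E]; first by lia.
have xE : x = v by apply: bruhat_len_eq xv _; rewrite E; apply: bruhat_step_len ux.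
by case: ux => _ [t [rt ut _]]; exists t => //; rewrite -xE.
Qed.

(** Write v = u t. If s_i keeps the positive root of t positive, conjugating t by s_i gives the new
    step; otherwise t = s_i. *)
Lemma bruhat_step_mul_sref u v i : bruhat_step C u v ->
  v = u *m s i \/ bruhat_step C (u *m s i) (v *m s i).
Proof.
move=> st; have Wv := bruhat_step_inWr st.
case: st => Wu [t [/(reflectionP hC)[x [j [Wx P ->]]] E L]].
have Wt : W (rfl C x j) by apply: inW_rfl.
rewrite len_ltP // E len_mul_rfl // in L.
case Q: (posr (s i *m x) j); last first.
  left; rewrite E; congr (_ *m _).
  by rewrite /rfl -(posr_sref_mul hC Wx P (negbT Q)) mulmxK // (inW_unit hC).
right; split; first by auto.
have Wsx : W (s i *m x) by auto.
exists (rfl C (s i *m x) j); split.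
- by apply/(reflectionP hC); exists (s i *m x), j.
- by rewrite -rfl_conj // (invmx_sref hC) E !mulmxA (mul_srefK hC).
rewrite len_ltP; auto.
have -> : v *m s i = u *m s i *m rfl C (s i *m x) j.
  by rewrite -rfl_conj // (invmx_sref hC) E !mulmxA (mul_srefK hC).
by rewrite len_mul_rfl //; auto; rewrite mulmxA (mul_srefK hC).
Qed.

Lemma bruhat_mul_sref_l u v i : u ≤ v -> u *m s i ≤ v \/ u *m s i ≤ v *m s i.
Proof.
move=> uv; have Wv := bruhat_inWr uv.
move: u uv; apply: bruhat_indl => [|u x ux xv].
  by right; apply: bruhat_refl; auto.
case: (bruhat_step_mul_sref i ux) => [E _|/bruhat_stepW ux']; first by left; rewrite -E.
by case=> H; [left|right]; apply: bruhat_trans ux' H.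
Qed.

Lemma bruhat_mul_sref_r u v i : u ≤ v -> u ≤ v *m s i \/ u *m s i ≤ v *m s i.
Proof.
move=> uv; have Wu := bruhat_inWl uv.
move: v uv; apply: bruhat_indr => [|x v ux xv].
  by right; apply: bruhat_refl; auto.
case: (bruhat_step_mul_sref i xv) => [E _|/bruhat_stepW xv'].
  by left; rewrite E (mul_srefK hC).
by case=> H; [left|right]; apply: bruhat_trans H xv'.
Qed.

Lemma bruhat_sref_up u i : W u -> posr u i -> u ≤ u *m s i.
Proof.
move=> Wu P; apply: bruhat_stepW; split=> //; exists (s i); split=> //.
  by apply/(reflectionP hC); exists 1%:M, i; rewrite rfl1 posr1.
by rewrite len_ltP; auto; have := len_mul_sref hC i Wu; rewrite P => ->.
Qed.

Lemma bruhat_sref_down u i : W u -> ~~ posr u i -> u *m s i ≤ u.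
Proof.
move=> Wu P; rewrite -[X in _ ≤ X](mul_srefK hC i); apply: bruhat_sref_up; first by auto.
by rewrite posr_mul_sref.
Qed.

(** The first of four forms of the lifting property: each takes the dichotomy of [bruhat_mul_sref_l]
    or [bruhat_mul_sref_r] and absorbs the unwanted alternative by one simple step. *)
Lemma lifting_mul u v i : u ≤ v -> ~~ posr v i -> u *m s i ≤ v.
Proof.
move=> uv N; have Wv := bruhat_inWr uv.
case: (bruhat_mul_sref_l i uv) => // H.
exact: bruhat_trans H (bruhat_sref_down Wv N).
Qed.

Lemma lifting u v i : u ≤ v -> ~~ posr v i -> posr u i -> u ≤ v *m s i.
Proof.
move=> uv N P; have Wu := bruhat_inWl uv.
case: (bruhat_mul_sref_r i uv) => // H.
exact: bruhat_trans (bruhat_sref_up Wu P) H.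
Qed.

Lemma lifting_down u v i : u ≤ v -> ~~ posr u i -> u *m s i ≤ v *m s i.
Proof.
move=> uv N; have Wu := bruhat_inWl uv.
case: (bruhat_mul_sref_r i uv) => // H.
exact: bruhat_trans (bruhat_sref_down Wu N) H.
Qed.

Lemma lifting_up u v i : u ≤ v -> posr v i -> u *m s i ≤ v *m s i.
Proof.
move=> uv P; have Wv := bruhat_inWr uv.
case: (bruhat_mul_sref_l i uv) => // H.
exact: bruhat_trans H (bruhat_sref_up Wv P).
Qed.

(** Conjugating the reflection by the smaller element turns right multiplication into left
    multiplication. This yields the left-handed lifting properties below. *)
Lemma bruhatV u v : u ≤ v -> invmx u ≤ invmx v.
Proof.
move=> uv; have Wu := bruhat_inWl uv.
move: v uv; apply: bruhat_indr => [|x v ux xv IH]; first by apply: bruhat_refl; auto.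
apply: bruhat_trans IH (bruhat_stepW _).
have [Wx Wv] := (bruhat_inWr ux, bruhat_step_inWr xv).
case: xv => _ [t [rt E L]]; have Wt := inW_reflection hC rt.
split; first by auto.
exists (x *m t *m invmx x); split; first exact: reflection_conj.
  rewrite !mulmxA mulVmx ?(inW_unit hC) // mul1mx E (invmxM hC) //.
  congr (_ *m _); by rewrite -[LHS]mulmx1 -(reflection_mul hC rt) mulKmx ?(inW_unit hC Wt).
by rewrite len_ltP; auto; rewrite !lenV // -len_ltP.
Qed.

Definition posl w i := posr (invmx w) i.

Lemma invmx_sref_mul i w : W w -> invmx (s i *m w) = invmx w *m s i.
Proof. by move=> Ww; rewrite (invmxM hC) // (invmx_sref hC). Qed.

Lemma len_sref_mul w i : W w ->
  if posl w i then len (s i *m w) = (len w).+1 else len w = (len (s i *m w)).+1.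
Proof.
move=> Ww; have := len_mul_sref hC i (inWV hC Ww); rewrite -invmx_sref_mul //.
by rewrite !lenV //; auto.
Qed.

Lemma bruhatVK u v : W u -> W v -> invmx u ≤ invmx v -> u ≤ v.
Proof. by move=> Wu Wv /bruhatV; rewrite !invmxK. Qed.

Lemma bruhat_srefl_up u i : W u -> posl u i -> u ≤ s i *m u.
Proof.
move=> Wu P; apply: bruhatVK; auto.
by rewrite invmx_sref_mul //; apply: bruhat_sref_up; auto.
Qed.
Lemma bruhat_srefl_down u i : W u -> ~~ posl u i -> s i *m u ≤ u.
Proof.
move=> Wu P; apply: bruhatVK; auto.
by rewrite invmx_sref_mul //; apply: bruhat_sref_down; auto.
Qed.
Lemma liftingl_mul u v i : u ≤ v -> ~~ posl v i -> s i *m u ≤ v.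
Proof.
move=> uv P; have [Wu Wv] := (bruhat_inWl uv, bruhat_inWr uv); apply: bruhatVK; auto.
by rewrite invmx_sref_mul //; apply: lifting_mul => //; apply: bruhatV.
Qed.
Lemma liftingl u v i : u ≤ v -> ~~ posl v i -> posl u i -> u ≤ s i *m v.
Proof.
move=> uv P Q; have [Wu Wv] := (bruhat_inWl uv, bruhat_inWr uv); apply: bruhatVK; auto.
by rewrite invmx_sref_mul //; apply: lifting => //; apply: bruhatV.
Qed.
Lemma liftingl_down u v i : u ≤ v -> ~~ posl u i -> s i *m u ≤ s i *m v.
Proof.
move=> uv P; have [Wu Wv] := (bruhat_inWl uv, bruhat_inWr uv); apply: bruhatVK; auto.
by rewrite !invmx_sref_mul //; apply: lifting_down => //; apply: bruhatV.
Qed.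
Lemma liftingl_up u v i : u ≤ v -> posl v i -> s i *m u ≤ s i *m v.
Proof.
move=> uv P; have [Wu Wv] := (bruhat_inWl uv, bruhat_inWr uv); apply: bruhatVK; auto.
by rewrite !invmx_sref_mul //; apply: lifting_up => //; apply: bruhatV.
Qed.
(** * Parabolic cosets *)

Lemma inWJ1 J : inWJ C J 1%:M. Proof. by exists [::]. Qed.
Lemma inWJ_sref (J : {set 'I_n}) i : i \in J -> inWJ C J (s i).
Proof. by move=> iJ; exists [:: i]; rewrite wordmx1 /= iJ. Qed.
Lemma inWJM J x y : inWJ C J x -> inWJ C J y -> inWJ C J (x *m y).
Proof.
by move=> [a [aJ <-]] [b [bJ <-]]; exists (a ++ b); rewrite all_cat aJ bJ wordmx_cat.
Qed.
Lemma inWJV J x : inWJ C J x -> inWJ C J (invmx x).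
Proof. by move=> [a [aJ <-]]; exists (rev a); rewrite all_rev (invmx_wordmx hC). Qed.
Lemma inWJ_inW J x : inWJ C J x -> W x.
Proof. by move=> [a [_ <-]]. Qed.
Lemma inWJ_sub (J K : {set 'I_n}) x : J \subset K -> inWJ C J x -> inWJ C K x.
Proof.
move=> JK [a [/allP aJ <-]]; exists a; split=> //.
by apply/allP=> i /aJ; apply: (subsetP JK).
Qed.
Hint Resolve inWJ1 inWJ_sref inWJM inWJV : core.

Lemma same_coset_refl J u : same_coset C J u u.
Proof. by exists 1%:M; rewrite mulmx1. Qed.
Lemma same_coset_trans J v u w : same_coset C J u v -> same_coset C J v w -> same_coset C J u w.
Proof. by move=> [x [Jx ->]] [y [Jy ->]]; exists (x *m y); rewrite mulmxA; auto. Qed.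
Lemma same_coset_sym J u v : same_coset C J u v -> same_coset C J v u.
Proof.
move=> [x [Jx ->]]; exists (invmx x); split; auto.
by rewrite mulmxK // (inW_unit hC (inWJ_inW Jx)).
Qed.
Lemma same_coset_sub (J K : {set 'I_n}) u v :
  J \subset K -> same_coset C J u v -> same_coset C K u v.
Proof. by move=> JK [x [Jx ->]]; exists x; split=> //; apply: inWJ_sub Jx. Qed.
Lemma same_coset_sref (J : {set 'I_n}) u i : i \in J -> same_coset C J u (u *m s i).
Proof. by move=> iJ; exists (s i); auto. Qed.
Lemma same_coset_inW J u v : same_coset C J u v -> W u -> W v.
Proof. by move=> [x [/inWJ_inW Wx ->]] Wu; auto. Qed.

(** If the last letter is not a descent, [exchange] shortens the word by deleting letters, so the
    letters stay in [J]. *)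
Lemma inWJ_descent J x : inWJ C J x -> x <> 1%:M -> exists2 i, i \in J & ~~ posr x i.
Proof.
case=> a [aJ <-]; have [k] := ubnP (size a); elim: k a aJ => // k IHk a.
case/lastP: a => [|a i] //; rewrite all_rcons size_rcons => /andP[iJ aJ] ak ne.
case P: (posr (wordmx C (rcons a i)) i); last by exists i; rewrite ?P.
have N : ~~ posr (wordmx C a *m 1%:M) i.
  by rewrite mulmx1 -(posr_mul_sref hC) ?wordmx_rcons // in P *.
have [b [ba sb E]] := exchange hC (inW1 C) (posr1 hC i) N.
rewrite rfl1 -wordmx_rcons in E.
rewrite -E; apply: IHk; last by rewrite E.
  by apply/allP=> j /(mem_subseq ba); apply: (allP aJ).
by rewrite ltnS sb in ak; apply: ltn_trans ak.
Qed.

Lemma rt_inWJ (J : {set 'I_n}) x k i : inWJ C J x -> i \in J -> k \notin J -> rt C x k i = 0.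
Proof.
case=> a [aJ <-] iJ kJ; elim: a aJ => [_|j a IH /= /andP[jJ aJ]].
  by rewrite (rt1 hC) mxE; case: eqP => // E; rewrite E iJ in kJ.
rewrite (rtM hC) // (rt_sref hC) rref_mulE IH //.
by case: eqP => [E|]; [rewrite E jJ in kJ | rewrite mul0r subr0].
Qed.

Definition ascJ (J : {set 'I_n}) w := forall i, i \in J -> posr w i.

(** [x] maps alpha_i to a combination of simple roots from [J] with coefficients of one sign, and
    [y] keeps each of these simple roots positive. *)
Lemma posr_ascJ_mul (J : {set 'I_n}) y x i :
  W y -> ascJ J y -> inWJ C J x -> i \in J -> posr (y *m x) i = posr x i.
Proof.
move=> Wy ay Jx iJ; have Wx := inWJ_inW Jx.
have E k : rt C (y *m x) k i = \sum_(l in J) rt C y k l * rt C x l i.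
  rewrite (rtM hC) // mxE (bigID (mem J)) /= [X in _ + X]big1 ?addr0 // => l lJ.
  by rewrite (rt_inWJ Jx iJ lJ) mulr0.
have ay' k l : l \in J -> 0 <= rt C y k l by move=> lJ; have /forallP := ay l lJ.
case P: (posr x i).
  apply/forallP=> k; rewrite E; apply: sumr_ge0 => l lJ.
  by apply: mulr_ge0; [apply: ay' | move/forallP: P].
apply/negP=> /forallP Q; have Wyx : W (y *m x) by auto.
have [k] := root_neq0 hC i Wyx; apply/negP; rewrite negbK eq_le Q andbT E.
apply: sumr_le0 => l lJ; apply: mulr_ge0_le0; first exact: ay'.
by apply: (root_sign hC) => //; rewrite P.
Qed.

Lemma ascJ_bruhat (J : {set 'I_n}) y x : W y -> ascJ J y -> inWJ C J x -> y ≤ y *m x.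
Proof.
move=> Wy ay; have [k] := ubnP (len x); elim: k x => // k IHk x xk Jx.
have Wx := inWJ_inW Jx.
have [->|ne] := classic (x = 1%:M); first by rewrite mulmx1; apply: bruhat_refl.
have [i iJ N] := inWJ_descent Jx ne.
have Wyx : W (y *m x) by auto.
have L := len_mul_sref hC i Wx; rewrite (negPf N) in L.
apply: bruhat_trans (IHk (x *m s i) _ _) _; auto; first by rewrite L ltnS in xk.
by rewrite mulmxA; apply: bruhat_sref_down => //; rewrite (posr_ascJ_mul Wy ay).
Qed.

Lemma minrepP J w : minrep C J w <-> W w /\ ascJ J w.
Proof.
split=> [[Ww H]|[Ww aw]].
  split=> // i iJ; have := H (s i) (inWJ_sref iJ).
  rewrite len_leP; auto; have := len_mul_sref hC i Ww.
  by case: (posr w i) => // ->; rewrite ltnn.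
split=> // x Jx; have Wx := inWJ_inW Jx; rewrite len_leP; auto.
exact: bruhat_len (ascJ_bruhat Ww aw Jx).
Qed.

Lemma minrep_inW J w : minrep C J w -> W w. Proof. by case. Qed.
Hint Resolve minrep_inW : core.

Lemma minrep_sub (J K : {set 'I_n}) w : J \subset K -> minrep C K w -> minrep C J w.
Proof.
move=> JK /minrepP[Ww aw]; apply/minrepP; split=> // i iJ.
by apply: aw; apply: (subsetP JK).
Qed.

Lemma minrep_le J u v : minrep C J u -> same_coset C J u v -> u ≤ v.
Proof. by move=> /minrepP[Wu au] [x [Jx ->]]; apply: ascJ_bruhat Jx. Qed.

Lemma minrep_uniq J u v : minrep C J u -> minrep C J v -> same_coset C J u v -> u = v.
Proof.
move=> mu mv uv; apply: bruhat_antisym; first exact: minrep_le uv.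
by apply: minrep_le mv _; apply: same_coset_sym.
Qed.

(** * Projection to minimal coset representatives *)

Lemma ex_proj J w : W w -> exists v, proj C J w v.
Proof.
have [k] := ubnP (len w); elim: k w => // k IHk w wk Ww.
have [a|] := boolP [forall i in J, posr w i].
  exists w; split; last exact: same_coset_refl.
  by apply/minrepP; split=> // i iJ; move/forall_inP: a; apply.
rewrite negb_forall => /existsP[i]; rewrite negb_imply => /andP[iJ N].
have L := len_mul_sref hC i Ww; rewrite (negPf N) in L.
have [||v [mv cv]] := IHk (w *m s i); auto; first by rewrite L ltnS in wk.
by exists v; split=> //; apply: same_coset_trans cv; apply: same_coset_sref.
Qed.

Definition mr J w := epsilon (inhabits 1%:M) (proj C J w).

Lemma mrP J w : W w -> proj C J w (mr J w).
Proof. by move=> Ww; apply: epsilon_spec; apply: ex_proj. Qed.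
Lemma mr_minrep J w : W w -> minrep C J (mr J w). Proof. by case/(mrP J). Qed.
Lemma mr_coset J w : W w -> same_coset C J w (mr J w). Proof. by case/(mrP J). Qed.
Lemma proj_mr J w v : W w -> proj C J w v -> v = mr J w.
Proof.
move=> Ww [mv cv]; apply: minrep_uniq mv (mr_minrep J Ww) _.
by apply: same_coset_trans (mr_coset J Ww); apply: same_coset_sym.
Qed.
Lemma mr_eq J u v : W u -> same_coset C J u v -> mr J u = mr J v.
Proof.
move=> Wu uv; have Wv := same_coset_inW uv Wu; apply: proj_mr => //.
by split; [apply: mr_minrep | apply: same_coset_trans (same_coset_sym uv) (mr_coset _ _)].
Qed.
Lemma mr_eqP J u v : W u -> W v -> mr J u = mr J v <-> same_coset C J u v.
Proof.
move=> Wu Wv; split=> [E|]; last exact: mr_eq.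
by apply: same_coset_trans (mr_coset J Wu) _; rewrite E; apply: same_coset_sym; apply: mr_coset.
Qed.
Lemma mr_id J w : minrep C J w -> mr J w = w.
Proof.
by move=> mw; symmetry; apply: proj_mr; [apply: minrep_inW mw | split=> //; apply: same_coset_refl].
Qed.
Lemma mr_le J w : W w -> mr J w ≤ w.
Proof.
by move=> Ww; apply: minrep_le (mr_minrep J Ww) _; apply: same_coset_sym; apply: mr_coset.
Qed.

(** Strip descents in [J] from [v] one by one; each is an ascent of [u], so lifting keeps [u]
    below. *)
Lemma minrep_le_mr J u v : minrep C J u -> u ≤ v -> u ≤ mr J v.
Proof.
move=> mu; have [k] := ubnP (len v); elim: k v => // k IHk v vk uv.
have Wv := bruhat_inWr uv.
have [a|] := boolP [forall i in J, posr v i].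
  rewrite mr_id //; apply/minrepP; split=> // i iJ; by move/forall_inP: a; apply.
rewrite negb_forall => /existsP[i]; rewrite negb_imply => /andP[iJ N].
have L := len_mul_sref hC i Wv; rewrite (negPf N) in L.
rewrite (mr_eq Wv (same_coset_sref v iJ)); apply: IHk; first by rewrite L ltnS in vk.
by apply: lifting => //; case/minrepP: mu => _; apply.
Qed.

Lemma mr_mono J u v : u ≤ v -> mr J u ≤ mr J v.
Proof.
move=> uv; have Wu := bruhat_inWl uv; apply: minrep_le_mr; first exact: mr_minrep.
exact: bruhat_trans (mr_le J Wu) uv.
Qed.

Lemma minrep1 J : minrep C J 1%:M.
Proof. by apply/minrepP; split=> // i _; apply: posr1. Qed.

Lemma bruhat1 w : W w -> 1%:M ≤ w.
Proof. by move=> Ww; rewrite -[w]mul1mx; apply: (@ascJ_bruhat setT) => //;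
  [move=> i _; apply: posr1 | exists (wd C w); split; [apply/allP=> i; rewrite inE | apply: wdK]]. Qed.

(** Deodhar's dichotomy: if some alpha_r with r in J becomes negative under s_i u, then u(alpha_r)
    is a multiple of alpha_i. *)
Lemma minrep_sref_mul J u i : minrep C J u ->
  minrep C J (s i *m u) \/ exists2 r, r \in J & s i *m u = u *m s r.
Proof.
move=> /minrepP[Wu au].
have [a|] := boolP [forall r in J, posr (s i *m u) r].
  left; apply/minrepP; split; first by auto.
  by move=> r rJ; move/forall_inP: a; apply.
rewrite negb_forall => /existsP[r]; rewrite negb_imply => /andP[rJ N].
by right; exists r => //; apply: posr_sref_mul => //; apply: au.
Qed.

Lemma minrep_sref_mul_down J u i : minrep C J u -> ~~ posl u i -> minrep C J (s i *m u).
Proof.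
move=> mu N; case: (minrep_sref_mul i mu) => // -[r rJ E].
case/minrepP: mu => Wu au; have := len_mul_sref hC r Wu; rewrite au // -E.
by have := len_sref_mul i Wu; rewrite (negPf N); lia.
Qed.

Lemma ex_left_descent w : W w -> w <> 1%:M -> exists i, ~~ posl w i.
Proof.
move=> Ww ne; have WV : W (invmx w) by auto.
have [||i _ N] := @inWJ_descent setT (invmx w); last by exists i.
  by exists (wd C (invmx w)); split; [apply/allP=> i; rewrite inE | apply: wdK].
by move=> E; apply: ne; rewrite -[w]invmxK E invmx1.
Qed.

(** The quotient is graded. For a left descent [i] of [v], s_i v is a coatom and serves if it lies
    above [u]. Otherwise a coatom w' between s_i u and s_i v yields s_i w', except where w' has left
    descent [i] or s_i w' lies in the coset of w'; then u is below w' and s_i v serves after all. *)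
Lemma minrep_coatom J u v : minrep C J u -> minrep C J v -> u ≤ v -> u <> v ->
  exists w, [/\ minrep C J w, u ≤ w, w ≤ v & len v = (len w).+1].
Proof.
have [k] := ubnP (len v); elim: k u v => // k IHk u v vk mu mv uv ne.
have [Wu Wv] := (minrep_inW mu, minrep_inW mv).
have [|i Nv] := ex_left_descent Wv.
  by move=> v1; apply: ne; apply: bruhat_len_eq => //; rewrite v1 len1.
have Lv := len_sref_mul i Wv; rewrite (negPf Nv) in Lv.
have msv := minrep_sref_mul_down mv Nv.
have svv := bruhat_srefl_down Wv Nv.
case Pu: (posl u i); first by exists (s i *m v); split=> //; apply: liftingl.
have Nu : ~~ posl u i by rewrite Pu.
have msu := minrep_sref_mul_down mu Nu.
have [||w' [mw' uw' w'v Lw']] := IHk (s i *m u) (s i *m v) _ msu msv (liftingl_down uv Nu).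
- by rewrite Lv ltnS in vk.
- by move=> E; apply: ne; rewrite -(srefK hC i u) E (srefK hC).
have Ww' := minrep_inW mw'.
have w'v' := bruhat_trans w'v svv.
case Pw: (posl w' i); last first.
  exists (s i *m v); split=> //; apply: bruhat_trans w'v.
  by rewrite -(srefK hC i u); apply: liftingl_mul => //; rewrite Pw.
have usw : u ≤ s i *m w' by rewrite -(srefK hC i u); apply: liftingl_up.
case: (minrep_sref_mul i mw') => [msw|[r rJ E]].
  exists (s i *m w'); split=> //; first exact: liftingl_mul.
  by have := len_sref_mul i Ww'; rewrite Pw; lia.
exists (s i *m v); split=> //; apply: bruhat_trans w'v.
rewrite -[w'](mr_id mw') (mr_eq Ww' (same_coset_sref w' rJ)) -E.
exact: minrep_le_mr.
Qed.

(** Take a left descent [i] of [v]. If it is an ascent of [u], the middle elements are s_i u and s_i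
    v. Otherwise multiply by s_i those lying between s_i u and s_i v; should one of them be [u]
    itself, s_i v takes its place. *)
Lemma bruhat_diamond u v : u ≤ v -> len v = (len u).+2 ->
  exists x y, [/\ x <> y, u ≤ x /\ x ≤ v, u ≤ y /\ y ≤ v, len x = (len u).+1 & len y = (len u).+1].
Proof.
have [k] := ubnP (len v); elim: k u v => // k IHk u v vk uv L.
have [Wu Wv] := (bruhat_inWl uv, bruhat_inWr uv).
have [|i Nv] := ex_left_descent Wv; first by move=> v1; rewrite v1 len1 in L.
have Lv := len_sref_mul i Wv; rewrite (negPf Nv) in Lv.
have svv := bruhat_srefl_down Wv Nv.
have Lu := len_sref_mul i Wu.
case Pu: (posl u i) Lu => Lu.
  exists (s i *m u), (s i *m v); split.
  - move=> E; have : u = v by rewrite -(srefK hC i u) E (srefK hC).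
    by move=> E'; rewrite E' in L; lia.
  - by split; [apply: bruhat_srefl_up | apply: liftingl_mul].
  - by split=> //; apply: liftingl.
  - by [].
  by lia.
have Nu : ~~ posl u i by rewrite Pu.
have [||x [y [xy [ux xv] [uy yv] Lx Ly]]] := IHk (s i *m u) (s i *m v) _ (liftingl_down uv Nu).
- by rewrite Lv ltnS in vk.
- by lia.
have up z : s i *m u ≤ z -> z ≤ s i *m v -> posl z i -> len z = (len (s i *m u)).+1 ->
    [/\ u ≤ s i *m z, s i *m z ≤ v & len (s i *m z) = (len u).+1].
  move=> uz zv Pz Lz; have Wz := bruhat_inWr uz; split.
  - by rewrite -(srefK hC i u); apply: liftingl_up.
  - by apply: liftingl_mul => //; apply: bruhat_trans svv.
  by have := len_sref_mul i Wz; rewrite Pz; lia.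
have down z : s i *m u ≤ z -> ~~ posl z i -> len z = (len (s i *m u)).+1 -> z = u.
  move=> uz Nz Lz; symmetry; apply: bruhat_len_eq; last by lia.
  by rewrite -(srefK hC i u); apply: liftingl_mul.
have case2 z z' : s i *m u ≤ z' -> z' ≤ s i *m v -> z = u -> z <> z' ->
    len z' = (len (s i *m u)).+1 -> z ≤ s i *m v ->
    exists x y, [/\ x <> y, u ≤ x /\ x ≤ v, u ≤ y /\ y ≤ v, len x = (len u).+1 & len y = (len u).+1].
  move=> uz' z'v zu zz' Lz' zv.
  have Pz' : posl z' i by apply/negPn/negP=> N; apply: zz'; rewrite (down z').
  have [a b c] := up z' uz' z'v Pz' Lz'.
  exists (s i *m z'), (s i *m v); split=> //; last by lia.
    move=> E; have z'E : z' = v by rewrite -(srefK hC i z') E (srefK hC).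
    by rewrite z'E in Lz'; lia.
  by split=> //; rewrite -zu.
case Px: (posl x i); last first.
  by apply: (case2 x y) => //; apply: down; rewrite ?Px.
case Py: (posl y i); last first.
  by apply: (case2 y x) => //; [apply: down; rewrite ?Py | move=> E; apply: xy].
have [a b c] := up x ux xv Px Lx; have [a' b' c'] := up y uy yv Py Ly.
exists (s i *m x), (s i *m y); split=> // E.
by apply: xy; rewrite -(srefK hC i x) E (srefK hC).
Qed.

(** * Longest elements of cosets and maximal representatives *)

Lemma ex_longest (J : {set 'I_n}) w : W w ->
  exists2 M, same_coset C J w M & forall i, i \in J -> ~~ posr M i.
Proof.
have [N HN] := len_bounded hC.
have [k] := ubnP (N - len w); elim: k w => // k IHk w wk Ww.
have [a|] := boolP [forall i in J, ~~ posr w i].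
  by exists w => [|i iJ]; [apply: same_coset_refl | move/forall_inP: a; apply].
rewrite negb_forall => /existsP[i]; rewrite negb_imply negbK => /andP[iJ P].
have L := len_mul_sref hC i Ww; rewrite P in L.
have B : (len (w *m s i) <= N)%N by apply: HN; auto.
have [||M cM dM] := IHk (w *m s i); auto.
  by lia.
by exists M => //; apply: same_coset_trans cM; apply: same_coset_sref.
Qed.

Lemma longest_mul (J : {set 'I_n}) M u v : (forall i, i \in J -> ~~ posr M i) ->
  u ≤ M -> same_coset C J u v -> v ≤ M.
Proof.
move=> dM uM [x [[a [aJ <-]] ->]]; elim: a u uM aJ => [|i a IH] u uM /=.
  by rewrite mulmx1.
move=> /andP[iJ aJ]; rewrite mulmxA; apply: IH => //.
by apply: lifting_mul => //; apply: dM.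
Qed.

Lemma ex_isMaxJ (J1 J2 : {set 'I_n}) w : J1 \subset J2 -> W w ->
  exists2 m, isMaxJ C J1 J2 m & same_coset C J2 w m.
Proof.
move=> J12 Ww; have [M cM dM] := ex_longest J2 Ww.
have WM := same_coset_inW cM Ww.
have cmr : same_coset C J2 M (mr J1 M) by apply: same_coset_sub J12 _; apply: mr_coset.
exists (mr J1 M); last exact: same_coset_trans cM cmr.
split=> [|v mv cv]; first exact: mr_minrep.
apply: minrep_le_mr => //; apply: longest_mul dM (bruhat_refl WM) _.
exact: same_coset_trans cmr cv.
Qed.

Lemma isMaxJ_mono (J1 J2 : {set 'I_n}) x y mx my : J1 \subset J2 -> x ≤ y ->
  isMaxJ C J1 J2 mx -> isMaxJ C J1 J2 my -> same_coset C J2 x mx -> same_coset C J2 y my ->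
  mx ≤ my.
Proof.
move=> J12 xy [mmx _] [mmy Hy] cx cy.
have [Wx Wy] := (bruhat_inWl xy, bruhat_inWr xy).
have [M cM dM] := ex_longest J2 Wy; have WM := same_coset_inW cM Wy.
have yM : y ≤ M by apply: longest_mul dM (bruhat_refl WM) (same_coset_sym cM).
have mxM : mx ≤ M by apply: longest_mul dM (bruhat_trans xy yM) cx.
apply: bruhat_trans (minrep_le_mr mmx mxM) _.
apply: Hy; first exact: mr_minrep.
apply: same_coset_trans (same_coset_sym cy) (same_coset_trans cM _).
by apply: same_coset_sub J12 _; apply: mr_coset.
Qed.

Lemma minrep_isMinJ (J1 J2 : {set 'I_n}) w : J1 \subset J2 -> minrep C J2 w -> isMinJ C J1 J2 w.
Proof.
by move=> J12 mw; split=> [|v _ cv]; [apply: minrep_sub mw | apply: minrep_le cv].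
Qed.

(** * Cosets as points in the orbit of a dominant weight *)

Lemma inWJ_weight (lam : 'cV[int]_n) x :
  inWJ C [set i | lam i 0 == 0] x -> x *m lam = lam.
Proof.
case=> a [aJ <-]; elim: a aJ => [_|i a IH /= /andP[]]; first by rewrite mul1mx.
rewrite inE => /eqP li aJ; rewrite -mulmxA IH // /sref mulmxBl mul1mx -mulmxA.
by rewrite delta_mul_col li scale0r mulmx0 subr0.
Qed.

Lemma coset_weight (lam : 'cV[int]_n) u v : W u -> W v -> (forall i, 0 <= lam i 0) ->
  same_coset C [set i | lam i 0 == 0] u v <-> u *m lam = v *m lam.
Proof.
move=> Wu Wv lam0; split=> [[x [Jx ->]]|E].
  by rewrite -mulmxA (inWJ_weight Jx).
exists (invmx u *m v); split; last by rewrite mulKVmx // (inW_unit hC).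
apply: dominant_stab => //; first by auto.
by rewrite -mulmxA -E mulKmx // (inW_unit hC).
Qed.

End Bruhat.

(** * Chains *)

Lemma ltn_sub_between (a b c k : nat) : (a < b -> b < c -> c - a < k.+1 ->
  (c - b < k) /\ (b - a < k))%N.
Proof. lia. Qed.

(** * Covers and rank in the family of index sets *)

Section IndexSets.
Variables (m : nat) (II : {set {set 'I_m}}).

Lemma not_covby (J K : {set 'I_m}) : J \in II -> K \in II -> J \proper K -> ~~ covby II J K ->
  exists L, [/\ L \in II, J \proper L & L \proper K].
Proof.
move=> JI KI JK; rewrite /covby JI KI JK /= negb_forall => /existsP[L].
by rewrite negb_imply negbK => /and3P[LI JL LK]; exists L.
Qed.

Lemma ex_covby (J K : {set 'I_m}) : J \in II -> K \in II -> J \proper K ->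
  exists2 L : {set 'I_m}, J \subset L & covby II L K.
Proof.
have [k] := ubnP (#|K| - #|J|); elim: k J => // k IHk J kJ JI KI JK.
have [cJK|nc] := boolP (covby II J K); first by exists J.
have [L [LI JL LK]] := not_covby JI KI JK nc.
have [||||M LM cM] := IHk L => //.
  by have [] := ltn_sub_between (proper_card JL) (proper_card LK) kJ.
by exists M => //; apply: subset_trans LM; apply: proper_sub.
Qed.

Lemma ex_minimalI (J : {set 'I_m}) : J \in II ->
  exists K, [/\ K \in II, minimalI II K & K \subset J].
Proof.
have [k] := ubnP #|J|; elim: k J => // k IHk J kJ JI.
have [mJ|] := boolP (minimalI II J); first by exists J.
rewrite negb_forall => /existsP[L]; rewrite negb_imply negbK => /andP[LI LJ].
have [||K [KI mK KL]] := IHk L => //; first exact: leq_trans (proper_card LJ) kJ.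
by exists K; split=> //; apply: subset_trans KL (proper_sub LJ).
Qed.

Variable rk : {set 'I_m} -> nat.
Hypothesis rk_covby : forall J K, covby II J K -> rk K = (rk J).+1.

(** The rank is only known to grow along covers, so choose some M covered by K and containing J, and
    recurse on J and M. *)
Lemma rk_proper (J K : {set 'I_m}) : J \in II -> K \in II -> J \proper K -> (rk J < rk K)%N.
Proof.
have [k] := ubnP (#|K| - #|J|); elim: k J K => // k IHk J K kJ JI KI JK.
have [cJK|nc] := boolP (covby II J K); first by rewrite (rk_covby cJK).
have [L [LI JL LK]] := not_covby JI KI JK nc.
have [M LM cM] := ex_covby JI KI JK.
have /and4P[MI _ MK _] := cM.
rewrite (rk_covby cM) ltnS.
have [->|JM] := eqVneq J M; first by [].
apply: ltnW; apply: IHk => //; last by rewrite properEneq JM.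
have JM' : J \proper M by rewrite properEneq JM.
by have [] := ltn_sub_between (proper_card JM') (proper_card MK) kJ.
Qed.

End IndexSets.

(** * The graded poset W(lambda, tau) and its maximal chains *)

Section Chains.
Variables (n : nat) (C : 'M[int]_n) (m : nat) (II : {set {set 'I_m}}).
Variables (lam : 'I_m -> 'I_n -> nat) (tau : 'M[int]_n) (rk : {set 'I_m} -> nat).
Hypothesis hC : finite_type_cartan C.
Hypothesis m_gt0 : (0 < m)%N.
Hypothesis IIT : setT \in II.
Hypothesis rk_min : forall I, I \in II -> minimalI II I -> rk I = 0%N.
Hypothesis rk_covby : forall J K, covby II J K -> rk K = (rk J).+1.
Hypothesis rk_max : forall I, I \in II -> maximalI II I -> rk I = m.-1.
Hypothesis tau_min : minrep C (JQ lam) tau.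

Local Notation W := (inW C).
Local Notation "u ≤ v" := (bruhat C u v) (at level 70, no associativity).
Local Notation len := (len C).
Local Notation JP := (JP II lam).
Local Notation JQ := (JQ lam).
Local Notation elt := (elt n m).
Local Notation elt0 := (elt0 n m).
Local Notation inX := (inWl C II lam tau).
Local Notation le := (@le_prod n C m).
Hint Resolve inW1 inW_sref inW_word inWM : core.

Definition lamw (I : {set 'I_m}) : 'cV[int]_n :=
  \col_j (\sum_(i in underline II I) lam i j)%:Z.

Lemma lamw_ge0 I j : 0 <= lamw I j 0. Proof. by rewrite mxE. Qed.
Lemma JP_lamw I : JP I = [set j | lamw I j 0 == 0].
Proof. by apply/setP=> j; rewrite !inE mxE. Qed.
Lemma lamw_eq0 I j : lamw I j 0 = 0 -> forall i, i \in underline II I -> lam i j = 0%N.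
Proof.
rewrite mxE => /eqP; rewrite eqz_nat => /eqP H i iI.
by move: H; rewrite (bigD1 i) //= => /eqP; rewrite addn_eq0 => /andP[/eqP].
Qed.
Lemma JQ_lam j : (j \in JQ) = [forall i, lam i j == 0%N].
Proof.
rewrite inE; apply/eqP/forallP => [H i|H]; last by apply: big1 => i _; apply/eqP.
by move: H; rewrite (bigD1 i) //= => /eqP; rewrite addn_eq0 => /andP[].
Qed.
Lemma JQ_JP I : JQ \subset JP I.
Proof.
apply/subsetP=> j; rewrite JQ_lam inE => /forallP H.
by apply/eqP; apply: big1 => i _; apply/eqP.
Qed.

Definition pr (p : elt) : elt := (mr C (JP p.2) p.1, p.2).
(** The rank function of the product poset. *)
Definition rho (p : elt) : nat := (len p.1 + rk p.2)%N.

Lemma inX_W p : inX p -> W p.1. Proof. by case=> [[]]. Qed.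
Hint Resolve inX_W : core.

Lemma pr_eqP p q : W p.1 -> W q.1 ->
  pr p = pr q <-> p.2 = q.2 /\ p.1 *m lamw p.2 = q.1 *m lamw p.2.
Proof.
move=> Wp Wq; rewrite /pr; split=> [[E1 E2]|[E2 E1]].
  split=> //; rewrite -E2 in E1; move/(mr_eqP hC _ Wp Wq): E1.
  by rewrite JP_lamw (coset_weight hC Wp Wq (lamw_ge0 _)).
rewrite -E2; congr (_, _); apply/(mr_eqP hC _ Wp Wq).
by rewrite JP_lamw (coset_weight hC Wp Wq (lamw_ge0 _)).
Qed.

Lemma le_prod_trans q p r : le p q -> le q r -> le p r.
Proof.
move=> [a b] [c d]; split; first exact: bruhat_trans a c.
exact: subset_trans b d.
Qed.
Lemma le_prod_refl p : W p.1 -> le p p.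
Proof. by move=> Wp; split=> //; apply: bruhat_refl. Qed.

Lemma rk_le (I J : {set 'I_m}) : I \in II -> J \in II -> I \subset J -> (rk I <= rk J)%N.
Proof.
move=> II' JI IJ; have [->//|ne] := eqVneq I J.
by apply: ltnW; apply: (rk_proper rk_covby) => //; rewrite properEneq ne.
Qed.

Lemma rk_eq (I J : {set 'I_m}) : I \in II -> J \in II -> I \subset J -> (rk J <= rk I)%N -> I = J.
Proof.
move=> II' JI IJ; apply: contraTeq => ne; rewrite -ltnNge.
by apply: (rk_proper rk_covby) => //; rewrite properEneq ne.
Qed.

Lemma rho_le p q : inX p -> inX q -> le p q -> (rho p <= rho q)%N.
Proof.
move=> [_ _ pI] [_ _ qI] [pq IJ]; apply: leq_add; first exact: bruhat_len hC _ _ pq.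
exact: rk_le.
Qed.

Lemma rho_eq p q : inX p -> inX q -> le p q -> (rho q <= rho p)%N -> p = q.
Proof.
move=> [_ _ pI] [_ _ qI] [pq IJ] L.
have L1 := bruhat_len hC pq; have L2 := rk_le pI qI IJ.
case: p q pI qI pq IJ L L1 L2 => [p1 p2] [q1 q2] /= pI qI pq IJ L L1 L2; rewrite /rho /= in L.
by congr (_, _); [apply: (bruhat_len_eq hC pq); lia | apply: rk_eq => //; lia].
Qed.

Definition rho_max := (len tau + m.-1)%N.
Definition top_elt : elt := (tau, setT).

Lemma tau_W : W tau. Proof. exact: minrep_inW tau_min. Qed.
Hint Resolve tau_W : core.
Lemma top_inX : inX top_elt. Proof. by split=> //; apply: bruhat_refl. Qed.
Lemma rho_top : rho top_elt = rho_max.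
Proof.
rewrite /rho /rho_max /= rk_max //; apply/forall_inP=> K _.
by rewrite properE subsetT andbF.
Qed.
Lemma le_top p : inX p -> le p top_elt. Proof. by case=> _ pt _; split=> //; apply: subsetT. Qed.
Lemma rho_le_N p : inX p -> (rho p <= rho_max)%N.
Proof. by move=> Xp; rewrite -rho_top; apply: rho_le => //; [apply: top_inX | apply: le_top]. Qed.

Lemma ex_bot p : inX p -> exists z, [/\ inX z, rho z = 0%N & le z p].
Proof.
move=> Xp; have Wp := inX_W Xp; have [mp ptau pI] := Xp; have [K [KI mK KJ]] := ex_minimalI pI.
exists (1%:M, K); split; last by split=> //; apply: bruhat1.
  by split=> //; [apply: (minrep1 hC) | apply: (bruhat1 hC)].
by rewrite /rho /= len1 rk_min.
Qed.

Lemma rho0 p : inX p -> rho p = 0%N -> p.1 = 1%:M.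
Proof. by move=> Xp; rewrite /rho => E; apply: (len_eq0 (inX_W Xp)); lia. Qed.

(** If the index sets agree, take a coatom in W/W_Q; otherwise keep the first component of [q] and
    lower its index set by a cover. *)
Lemma le_prod_coatom p q : inX p -> inX q -> le p q -> p <> q ->
  exists z, [/\ inX z, le p z, le z q & rho q = (rho z).+1].
Proof.
case: p q => [p1 p2] [q1 q2] Xp Xq [/= pq IJ] ne.
have [Wp Wq] : W p1 /\ W q1 by split; [apply: (inX_W Xp) | apply: (inX_W Xq)].
have [mp ptau pI] := Xp; have [mq qtau qI] := Xq; move: mp ptau pI mq qtau qI => /= mp ptau pI mq qtau qI.
have [E|ne2] := eqVneq p2 q2.
  have [|w [mw pw wq L]] := minrep_coatom hC mp mq pq; first by move=> E1; apply: ne; rewrite E1 E.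
  exists (w, q2); split.
  - by split=> //=; apply: bruhat_trans wq qtau.
  - by split=> //=.
  - by split=> //=.
  by rewrite /rho /= L.
have [|L JL cL] := ex_covby pI qI; first by rewrite properEneq ne2.
have /and4P[LI _ LK _] := cL.
exists (q1, L); split=> //.
- by split=> //=; [apply: bruhat_refl | apply: proper_sub].
by rewrite /rho /= (rk_covby cL) addnS.
Qed.

(** Chains without gaps are functions indexed by rank, so that one element can be replaced without
    renumbering. *)
Definition saturated a b (e : nat -> elt) :=
  (forall k, (a <= k <= b)%N -> inX (e k) /\ rho (e k) = k) /\
  (forall k, (a <= k < b)%N -> le (e k) (e k.+1)).

Lemma sat_cat a b c e e' : saturated a b e -> saturated b c e' -> e b = e' b ->
  saturated a c (fun k => if (k <= b)%N then e k else e' k).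
Proof.
move=> [H1 H2] [H1' H2'] E; split=> k kab.
  by case: (leqP k b) => kb; [apply: H1 | apply: H1']; lia.
case: (leqP k.+1 b) => kb; first by rewrite ltnW //; apply: H2; lia.
case: (leqP k b) => kb'; last by apply: H2'; lia.
have -> : k = b by lia.
by rewrite E; apply: H2'; lia.
Qed.

Lemma sat_fill p q : inX p -> inX q -> le p q ->
  exists e, [/\ saturated (rho p) (rho q) e, e (rho p) = p & e (rho q) = q].
Proof.
have [k] := ubnP (rho q - rho p)%N; elim: k q => // k IHk q kq Xp Xq pq.
have [E|ne] := classic (p = q).
  rewrite -E; exists (fun _ => p); split=> //; split=> l lp; last by apply: le_prod_refl; auto.
  by split=> //; lia.
have [z [Xz pz zq L]] := le_prod_coatom Xp Xq pq ne.
have rpz := rho_le Xp Xz pz.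
have [|||| e [[H1 H2] ep ez]] := IHk z => //; first by lia.
exists (fun k => if k == rho q then q else e k); split; last 2 first.
- by rewrite ifN //; apply/eqP; lia.
- by rewrite eqxx.
split=> l lpq; first by case: eqVneq => [->//|ne']; apply: H1; lia.
have -> : (l == rho q) = false by apply/eqP; lia.
case: eqVneq => [E|ne']; last by apply: H2; lia.
by have -> : l = rho z by [lia]; rewrite ez.
Qed.

Definition full_chain := saturated 0 rho_max.

Lemma full_inX e k : full_chain e -> (k <= rho_max)%N -> inX (e k).
Proof. by move=> [H _] kN; have [] := H k kN. Qed.
Lemma full_rho e k : full_chain e -> (k <= rho_max)%N -> rho (e k) = k.
Proof. by move=> [H _] kN; have [] := H k kN. Qed.
Lemma full_le e i j : full_chain e -> (i <= j <= rho_max)%N -> le (e i) (e j).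
Proof.
move=> fe; elim: j => [|j IH] /andP[ij jN].
  by have -> : i = 0%N by [lia]; apply: le_prod_refl; apply: inX_W (full_inX fe _).
case: (leqP i j) => ij'.
  by apply: (le_prod_trans (IH _)); [lia | case: fe => _; apply; lia].
by have -> : i = j.+1 by [lia]; apply: le_prod_refl; apply: inX_W (full_inX fe _).
Qed.
Lemma full_top e : full_chain e -> e rho_max = top_elt.
Proof.
move=> fe; have Xe := full_inX fe (leqnn rho_max).
by apply: rho_eq => //; [apply: top_inX | apply: le_top | rewrite rho_top (full_rho fe)].
Qed.

(** The rank grows by one, so exactly one of the two components moves. *)
Lemma full_step e k : full_chain e -> (k < rho_max)%N ->
  ((e k).2 = (e k.+1).2 /\ len (e k.+1).1 = (len (e k).1).+1) \/
  ((e k).1 = (e k.+1).1 /\ covby II (e k).2 (e k.+1).2).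
Proof.
move=> fe kN; have X1 := full_inX fe (ltnW kN); have X2 := full_inX fe kN.
have R1 := full_rho fe (ltnW kN); have R2 := full_rho fe kN.
have [L1 L2] : le (e k) (e k.+1) by apply: full_le => //; lia.
have [m1 _ I1] := X1; have [m2 _ I2] := X2.
rewrite /rho in R1 R2.
have B := bruhat_len hC L1.
have [E|ne] := eqVneq (e k).2 (e k.+1).2; [left|right].
  by split=> //; rewrite E in R1; lia.
have P : (e k).2 \proper (e k.+1).2 by rewrite properEneq ne.
have P' := rk_proper rk_covby I1 I2 P.
split; first by apply: (bruhat_len_eq hC) => //; lia.
apply/negPn/negP=> nc; have [L [LI kL Lk]] := not_covby I1 I2 P nc.
have := rk_proper rk_covby I1 LI kL; have := rk_proper rk_covby LI I2 Lk; lia.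
Qed.

Lemma Wchain_le d i j : Wchain C II lam tau d -> (i <= j < size d)%N -> le (nth elt0 d i) (nth elt0 d j).
Proof.
move=> [Xd Hd]; elim: j => [|j IH] /andP[ij js].
  by have -> : i = 0%N by [lia]; apply: le_prod_refl; apply: inX_W; apply: Xd; apply: mem_nth.
case: (leqP i j) => ij'; first by apply: (le_prod_trans (IH _)); [lia | case: (Hd j js)].
by have -> : i = j.+1 by [lia]; apply: le_prod_refl; apply: inX_W; apply: Xd; apply: mem_nth.
Qed.

Lemma Wchain_rho d i j : Wchain C II lam tau d -> (i < j < size d)%N ->
  (rho (nth elt0 d i) < rho (nth elt0 d j))%N.
Proof.
move=> Wd /andP[ij js]; have [Xd Hd] := Wd.
have Xi k : (k < size d)%N -> inX (nth elt0 d k) by move=> ks; apply: Xd; apply: mem_nth.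
have [L ne] : lt_prod C (nth elt0 d i) (nth elt0 d i.+1) by apply: Hd; lia.
apply: (@leq_trans (rho (nth elt0 d i.+1))); last first.
  by apply: rho_le; [apply: Xi; lia | apply: Xi | apply: Wchain_le => //; lia].
rewrite ltnNge; apply/negP=> R; apply: ne; apply: rho_eq => //; apply: Xi; lia.
Qed.

Lemma Wchain_extend d : Wchain C II lam tau d ->
  exists2 e, full_chain e & forall k, (k < size d)%N -> e (rho (nth elt0 d k)) = nth elt0 d k.
Proof.
move=> Wd; have [Xd Hd] := Wd.
have Xi k : (k < size d)%N -> inX (nth elt0 d k) by move=> ks; apply: Xd; apply: mem_nth.
have H k : (k < size d)%N -> exists2 e, saturated 0 (rho (nth elt0 d k)) e &
   forall j, (j <= k)%N -> e (rho (nth elt0 d j)) = nth elt0 d j.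
  elim: k => [|k IH] ks.
    have [z [Xz rz zd]] := ex_bot (Xi 0%N ks).
    have [e [se _ ed]] := sat_fill Xz (Xi 0%N ks) zd.
    by rewrite rz in se; exists e => [//|j]; rewrite leqn0 => /eqP->.
  have ks' := ltnW ks; have [e se ed] := IH ks'.
  have [|e' [se' e1 e2]] := sat_fill (Xi k ks') (Xi k.+1 ks); first by apply: Wchain_le => //; lia.
  exists (fun l => if (l <= rho (nth elt0 d k))%N then e l else e' l).
    by apply: sat_cat se se' _; rewrite ed // e1.
  move=> j jk; case: (leqP j k) => jk'.
    rewrite ifT ?ed //; apply: rho_le; [apply: Xi | apply: Xi | apply: Wchain_le => //]; lia.
  have -> : j = k.+1 by lia.
  by rewrite ifN // -ltnNge; apply: Wchain_rho => //; lia.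
case: (posnP (size d)) => [d0|d_gt0].
  have [z [Xz rz zt]] := ex_bot top_inX.
  have [e [se _ _]] := sat_fill Xz top_inX zt.
  by exists e => [|k]; [rewrite /full_chain -rho_top -rz | rewrite d0].
have ks : ((size d).-1 < size d)%N by lia.
have [e se ed] := H _ ks.
have [e' [se' e1 e2]] := sat_fill (Xi _ ks) top_inX (le_top (Xi _ ks)).
exists (fun l => if (l <= rho (nth elt0 d (size d).-1))%N then e l else e' l).
  by rewrite /full_chain -rho_top; apply: sat_cat se se' _; rewrite ed // e1.
move=> j jk; rewrite ifT ?ed //; first by lia.
by apply: rho_le; [apply: Xi | apply: Xi | apply: Wchain_le => //]; lia.
Qed.

(** * Images of chains in the quotient poset *)

Lemma pr_inUW p : inX p -> inUW C II lam tau (pr p).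
Proof.
move=> Xp; have Wp := inX_W Xp; have [mp ptau pI] := Xp; split=> //=; first exact: mr_minrep.
exists (mr C (JP p.2) tau); split; first exact: mrP hC _ _ tau_W.
exact: mr_mono.
Qed.

Lemma pr_uge p q : inX p -> inX q -> le p q -> uge C II lam tau (pr q) (pr p).
Proof.
move=> Xp Xq [pq IJ]; have [Wp Wq] := (inX_W Xp, inX_W Xq).
apply: t_step; split=> //; [exact: pr_inUW | exact: pr_inUW |].
have [M mM cM] := ex_isMaxJ hC (JQ_JP q.2) Wq.
exists M, (mr C (JP p.2) p.1); split=> //=.
- by apply: same_coset_trans (same_coset_sym hC cM) (mr_coset hC _ Wq).
- by apply: (minrep_isMinJ hC (JQ_JP _)); apply: mr_minrep.
- exact: same_coset_refl.
apply: bruhat_trans (mr_le hC _ Wp) (bruhat_trans pq _).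
by case: mM => _; apply; [case: Xq | apply: same_coset_sym].
Qed.

Lemma pr_proj p : W p.1 -> proj C (JP p.2) p.1 (pr p).1. Proof. exact: mrP. Qed.

Lemma defining_pr c d k : defining C II lam tau c d -> (k < size c)%N ->
  nth elt0 c k = pr (nth elt0 d k).
Proof.
move=> [sz [Xd _] H] kc; have [E P] := H k kc.
have Wd : W (nth elt0 d k).1 by apply: inX_W; apply: Xd; apply: mem_nth; rewrite sz.
by rewrite [LHS]surjective_pairing /pr E (proj_mr hC Wd P).
Qed.

(** Elements of [e] with equal consecutive images are merged; keeping the lowest of each run gives a
    defining chain. *)
Lemma tau_standard_image e : full_chain e -> exists2 c, tau_standard C II lam tau c &
  forall p, p \in c <-> exists2 k, (k <= rho_max)%N & p = pr (e k).
Proof.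
move=> fe.
suff H l : (l <= rho_max)%N -> exists c d, [/\ uchain C II lam tau c, defining C II lam tau c d,
    (0 < size d)%N /\ nth elt0 c (size d).-1 = pr (e l),
    le (nth elt0 d (size d).-1) (e l) &
    forall p, p \in c <-> exists2 k, (k <= l)%N & p = pr (e k)].
  by have [c [d [uc dc _ _ H']]] := H rho_max (leqnn rho_max); exists c => //; split=> //; exists d.
elim: l => [_|l IH lN].
  have X0 := full_inX fe (leq0n rho_max); have W0 := inX_W X0.
  exists [:: pr (e 0%N)], [:: e 0%N]; split=> //.
  - by split=> [p|k //]; rewrite inE => /eqP->; apply: pr_inUW.
  - split=> //; first by split=> [p|k //]; rewrite inE => /eqP->.
    by case=> // _; split=> //=; apply: pr_proj.
  - exact: le_prod_refl.
  - move=> p; rewrite inE; split=> [/eqP->|[k]]; first by exists 0%N.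
    by rewrite leqn0 => /eqP-> ->.
have [c [d [uc dc [d0 cl] dl H]]] := IH (ltnW lN).
have Xl := full_inX fe lN; have Wl := inX_W Xl.
have ll : le (e l) (e l.+1) by apply: full_le => //; lia.
have [E|ne] := eqVneq (pr (e l)) (pr (e l.+1)).
  exists c, d; split=> //; first by rewrite cl.
    exact: le_prod_trans dl ll.
  move=> p; rewrite H; split=> [[k kl ->]|[k kl ->]]; first by exists k => //; lia.
  by move: kl; rewrite leq_eqVlt => /predU1P[->|kl]; [exists l => // | exists k].
have [sz Wd Hd] := dc; have [Xd Hd'] := Wd; have [Uc Hc] := uc.
have dne : nth elt0 d (size d).-1 <> e l.+1.
  move=> E; have kc : ((size d).-1 < size c)%N by lia.
  by have := defining_pr dc kc; rewrite cl E => /eqP; rewrite (negPf ne).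
exists (rcons c (pr (e l.+1))), (rcons d (e l.+1)); split.
- split=> [p|k].
    by rewrite mem_rcons inE => /predU1P[->|/Uc//]; apply: pr_inUW.
  rewrite size_rcons ltnS => kc; rewrite !nth_rcons kc.
  case: (ltnP k.+1 (size c)) => kc'; first exact: Hc.
  have -> : k.+1 = size c by lia.
  rewrite eqxx; have -> : k = (size d).-1 by lia.
  rewrite cl; split; last by apply/eqP; rewrite eq_sym.
  by apply: pr_uge => //; apply: full_inX fe _; apply: ltnW.
- split; first by rewrite !size_rcons sz.
    split=> [p|k]; first by rewrite mem_rcons inE => /predU1P[->|/Xd].
    rewrite size_rcons ltnS => kd; rewrite !nth_rcons kd.
    case: (ltnP k.+1 (size d)) => kd'; first exact: Hd'.
    have -> : k.+1 = size d by lia.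
    rewrite eqxx; have -> : k = (size d).-1 by lia.
    by split=> //; apply: le_prod_trans dl ll.
  move=> k; rewrite size_rcons ltnS => kc; rewrite !nth_rcons sz.
  case: (ltnP k (size c)) => kc'; first exact: Hd.
  have -> : k = size c by lia.
  by rewrite eqxx; split=> //=; apply: pr_proj.
- rewrite size_rcons /= sz; split=> //.
  by rewrite nth_rcons ltnn eqxx.
- by rewrite size_rcons /= nth_rcons ltnn eqxx; apply: le_prod_refl.
move=> p; rewrite mem_rcons inE; split=> [/predU1P[->|/H[k kl ->]]|[k kl ->]].
- by exists l.+1.
- by exists k => //; lia.
move: kl; rewrite leq_eqVlt => /predU1P[->|kl]; first by rewrite eqxx.
by apply/orP; right; apply/H; exists k.
Qed.

Lemma pr_squeeze x y z : inX x -> inX y -> inX z -> le x y -> le y z -> pr x = pr z -> pr y = pr x.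
Proof.
move=> Xx Xy Xz [xy Ixy] [yz Iyz] [E1 E2].
have I : y.2 = x.2 by apply/eqP; rewrite eqEsubset Ixy andbT E2.
rewrite /pr I; congr (_, _); rewrite -E2 in E1.
apply: (bruhat_antisym hC); last exact: mr_mono.
by rewrite E1; apply: mr_mono.
Qed.

(** Only one inclusion is required; when [c] is maximal, [state_image] provides the other. *)
Definition covers_chain (c : seq elt) e := full_chain e /\ forall p, p \in c -> exists2 k, (k <= rho_max)%N & p = pr (e k).

Definition upd (e : nat -> elt) j x k := if k == j then x else e k.

Lemma upd_full e j x : full_chain e -> (j.+2 <= rho_max)%N -> inX x -> rho x = j.+1 ->
  le (e j) x -> le x (e j.+2) -> full_chain (upd e j.+1 x).
Proof.
move=> fe jN Xx rx l1 l2; split=> k kN; rewrite /upd.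
  case: eqVneq => [->//|_]; split; [apply: (full_inX fe) | apply: (full_rho fe)]; lia.
case: eqVneq => [->|ne]; first by rewrite ifN //; apply/eqP; lia.
case: eqVneq => [[->]//|_]; apply: full_le => //; lia.
Qed.

Lemma inW_mulI (p : nat) u (A B : 'M[int]_(n, p)) : W u -> u *m A = u *m B -> A = B.
Proof. by move=> Wu; apply: (can_inj (mulKmx (inW_unit hC Wu))). Qed.

Lemma diamond_other u w v : u ≤ w -> w ≤ v -> len w = (len u).+1 -> len v = (len w).+1 ->
  exists x a b, [/\ x <> w, u ≤ x, x ≤ v & len x = (len u).+1] /\
    [/\ reflection C a, reflection C b, x = u *m a & v = x *m b].
Proof.
move=> uw wv Lw Lv; have uv := bruhat_trans uw wv.
have L2 : len v = (len u).+2 by lia.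
have [x [y [xy [ux xv] [uy yv] Lx Ly]]] := bruhat_diamond hC uv L2.
suff [z [zw uz zv Lz]] : exists z, [/\ z <> w, u ≤ z, z ≤ v & len z = (len u).+1].
  have [a ra za] := bruhat_cover hC uz Lz.
  have [|b rb vb] := bruhat_cover hC zv; first by rewrite Lz.
  by exists z, a, b.
have [xw|xw] := classic (x = w); last by exists x.
by exists y; split=> // yw; apply: xy; rewrite xw.
Qed.

(** The projection of [x] lies between [u] and [x], whose lengths differ by one. This is needed
    because [bruhat_diamond] works in W and its middle elements may fail to be minimal
    representatives. *)
Lemma cover_minrep J u x : minrep C J u -> u ≤ x -> len x = (len u).+1 ->
  minrep C J x \/ same_coset C J u x.
Proof.
move=> mu ux Lx; have Wx := bruhat_inWr hC ux.
have u_mr := minrep_le_mr hC mu ux; have mr_x := mr_le hC J Wx.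
have [E|ne] := classic (mr C J x = x); first by left; rewrite -E; apply: mr_minrep.
right; suff -> : u = mr C J x by apply: (same_coset_sym hC); apply: mr_coset.
apply: (bruhat_len_eq hC u_mr); rewrite -ltnS -Lx ltnNge.
by apply/negP=> L; apply: ne; apply: (bruhat_len_eq hC).
Qed.

Lemma coset_lamw I u v : W u -> W v -> same_coset C JQ u v -> u *m lamw I = v *m lamw I.
Proof.
move=> Wu Wv /(same_coset_sub (JQ_JP I)).
by rewrite JP_lamw (coset_weight hC Wu Wv (lamw_ge0 _)).
Qed.

Lemma full_step_eq e k : full_chain e -> (k < rho_max)%N -> (e k).2 = (e k.+1).2 ->
  len (e k.+1).1 = (len (e k).1).+1.
Proof.
move=> fe kN E; case: (full_step fe kN) => [[]//|[_]].
by rewrite E => /and4P[_ _]; rewrite properxx.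
Qed.

Lemma full_step_neq e k : full_chain e -> (k < rho_max)%N -> (e k).2 <> (e k.+1).2 ->
  (e k).1 = (e k.+1).1 /\ covby II (e k).2 (e k.+1).2.
Proof. by move=> fe kN ne; case: (full_step fe kN) => // -[]. Qed.

(** Take the first index set of the chain that contains [a]: it is either minimal, or covers its
    predecessor, which omits [a]. *)
Lemma full_underline e a : full_chain e -> exists2 i, (i <= rho_max)%N & a \in underline II (e i).2.
Proof.
move=> fe.
have ex : exists i, (i <= rho_max)%N && (a \in (e i).2).
  by exists rho_max; rewrite leqnn (full_top fe) inE.
case: (ex_minnP ex) => -[|i] /andP[iN ai] Hmin.
  exists 0%N => //; rewrite /underline ifT //.
  apply/forall_inP=> K KI; apply/negP=> KJ.
  have Xe := full_inX fe (leq0n rho_max); have [_ _ JI] := Xe.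
  by have := rk_proper rk_covby KI JI KJ; have := full_rho fe (leq0n rho_max); rewrite /rho; lia.
exists i.+1 => //.
have na : a \notin (e i).2.
  by apply/negP=> ai'; have := Hmin i; rewrite ai' (ltnW iN) ltnn => /(_ isT).
have [|_ cv] := full_step_neq fe iN; first by move=> E; rewrite E ai in na.
have /and4P[eI _ pe _] := cv.
rewrite /underline ifN; last first.
  by rewrite negb_forall; apply/existsP; exists (e i).2; rewrite eI pe.
by apply/bigcupP; exists (e i).2; rewrite ?eI ?inE ?na.
Qed.

(** Sum the weights along the chain: by [full_underline] this dominant weight vanishes only at nodes
    of [JQ], and [dominant_stab] applies. *)
Lemma full_fix_JQ e t : full_chain e -> W t ->
  (forall i, (i <= rho_max)%N -> t *m lamw (e i).2 = lamw (e i).2) -> inWJ C JQ t.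
Proof.
move=> fe Wt H; pose L := \sum_(i < rho_max.+1) lamw (e i).2.
have LE j : L j 0 = \sum_(i < rho_max.+1) lamw (e i).2 j 0 by rewrite summxE.
have L0 j : 0 <= L j 0 by rewrite LE; apply: sumr_ge0 => i _; apply: lamw_ge0.
have tL : t *m L = L.
  by rewrite mulmx_sumr; apply: eq_bigr => i _; apply: H; rewrite -ltnS.
apply: inWJ_sub (dominant_stab hC Wt L0 tL).
apply/subsetP=> j; rewrite inE JQ_lam LE => Lj; apply/forallP=> a.
have [i iN ai] := full_underline a fe.
apply/eqP; apply: (@lamw_eq0 (e i).2) ai.
move: Lj; rewrite psumr_eq0 => [/allP/(_ (Ordinal (iN : (i < rho_max.+1)%N)))|k _]; last exact: lamw_ge0.
by rewrite mem_index_enum => /(_ isT) /eqP.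
Qed.

Lemma pr_reflection p q t : W p.1 -> W q.1 -> pr p = pr q -> q.1 = p.1 *m t ->
  t *m lamw p.2 = lamw p.2.
Proof.
move=> Wp Wq /(pr_eqP Wp Wq)[_ E] qE; apply: (inW_mulI Wp).
by rewrite mulmxA -qE.
Qed.

(** * Exchanging collapsing steps over a maximal standard chain *)

Section Maximal.
Variable c : seq elt.
Hypothesis c_max : maximal_standard C II lam tau c.

Lemma state_image e k : covers_chain c e -> (k <= rho_max)%N -> pr (e k) \in c.
Proof.
move=> [fe ce] kN; have [c' sc' c'E] := tau_standard_image fe.
case: c_max => _ H; apply: (H c' sc'); last by apply/c'E; exists k.
by move=> p /ce ?; apply/c'E.
Qed.

(** The replaced element shares its image with a neighbour, so no image is lost. By maximality the
    new image is already in [c], and monotonicity of [pr] leaves only the two neighbouring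
    images. *)
Lemma upd_state e j x : covers_chain c e -> (j.+2 <= rho_max)%N -> inX x -> rho x = j.+1 ->
  le (e j) x -> le x (e j.+2) ->
  pr (e j.+1) = pr (e j) \/ pr (e j.+1) = pr (e j.+2) ->
  covers_chain c (upd e j.+1 x) /\ (pr x = pr (e j) \/ pr x = pr (e j.+2)).
Proof.
move=> se jN Xx rx l1 l2 E; have [fe ce] := se.
have su : covers_chain c (upd e j.+1 x).
  split; first exact: upd_full.
  move=> p /ce[k kN ->]; case: (eqVneq k j.+1) => [->|ne]; last first.
    by exists k; rewrite // /upd (negPf ne).
  case: E => ->; [exists j; first by lia|exists j.+2 => //]; rewrite /upd ifN //; lia.
split=> //.
have : pr x \in c.
  by have := @state_image _ j.+1 su; rewrite /upd eqxx; apply; lia.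
have Xe k : (k <= rho_max)%N -> inX (e k) by apply: full_inX.
move=> /ce[k kN xk].
case: (leqP k j) => kj.
  left; rewrite xk; symmetry; apply: pr_squeeze (Xe _ _) (Xe _ _) Xx _ l1 _ => //; first lia.
  by apply: full_le => //; lia.
case: (leqP j.+2 k) => jk.
  right; symmetry; apply: pr_squeeze Xx (Xe _ _) (Xe _ kN) l2 _ xk => //.
  by apply: full_le => //; lia.
have kE : k = j.+1 by lia.
by rewrite xk kE; case: E => ->; [left|right].
Qed.

Lemma swap_up e j : covers_chain c e -> (j.+2 <= rho_max)%N -> pr (e j) = pr (e j.+1) ->
  pr (e j.+1) <> pr (e j.+2) ->
  exists x, [/\ covers_chain c (upd e j.+1 x), pr x <> pr (e j) & pr x = pr (e j.+2)].
Proof.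
move=> se jN E ne; have [fe ce] := se.
suff [x [Xx rx l1 l2 nx]] : exists x, [/\ inX x, rho x = j.+1, le (e j) x, le x (e j.+2) &
    pr x <> pr (e j)].
  by have [su [//|Ex]] := upd_state se jN Xx rx l1 l2 (or_introl (esym E)); exists x.
have jN1 : (j.+1 <= rho_max)%N by apply: ltnW.
have [X0 X1 X2] : [/\ inX (e j), inX (e j.+1) & inX (e j.+2)].
  by split; apply: full_inX => //; lia.
have [W0 W1 W2] : [/\ W (e j).1, W (e j.+1).1 & W (e j.+2).1] by split; apply: inX_W.
have l01 : le (e j) (e j.+1) by apply: full_le => //; lia.
have l12 : le (e j.+1) (e j.+2) by apply: full_le => //; lia.
have E2 : (e j).2 = (e j.+1).2 := congr1 snd E.
have Lw := full_step_eq fe jN1 E2.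
have r0 := full_rho fe (ltnW jN1).
have [m0 t0 I0] := X0; have [m2 t2 I2] := X2.
have [E2'|ne2] := eqVneq (e j.+1).2 (e j.+2).2; last first.
  have [E1 _] := full_step_neq fe jN (elimN eqP ne2).
  (* The upper step changes only the index set, so the two steps commute. *)
  exists ((e j).1, (e j.+2).2); split.
  - by [].
  - have := full_rho fe jN; rewrite /rho /= -E1 Lw; lia.
  - by split=> /=; [apply: bruhat_refl | rewrite E2; case: l12].
  - by split=> //=; case: (le_prod_trans l01 l12).
  by case=> _ /= E3; case/eqP: ne2; rewrite -E2.
have Lv := full_step_eq fe jN E2'.
have [uw _] := l01; have [wv _] := l12.
have [x [a [b [[xw ux xv Lx] [ra rb xa vb]]]]] := diamond_other uw wv Lw Lv.
have [t rt wt] := bruhat_cover hC uw Lw; have [t' rt' vt] := bruhat_cover hC wv Lv.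
have Wx := bruhat_inWr hC ux.
set L := lamw (e j).2.
have uL : (e j).1 *m L = (e j.+1).1 *m L by case/(pr_eqP W0 W1): E.
have wL : (e j.+1).1 *m L <> (e j.+2).1 *m L.
  by move=> H; apply: ne; apply/(pr_eqP W1 W2); split; [exact: E2' | rewrite -E2].
have tL : t *m L = L by apply: (inW_mulI W0); rewrite mulmxA -wt.
have t'L : t' *m L <> L by move=> H; apply: wL; rewrite vt -mulmxA H.
(* If the other middle element had the image of [e j], then [a] and [t] would both fix [L], so b = a
   t t' and t' would agree on [L], where t' acts nontrivially. Hence b = t', a = t and x is the old
   middle element. *)
have xL : x *m L <> (e j).1 *m L.
  move=> H; have aL : a *m L = L by apply: (inW_mulI W0); rewrite mulmxA -xa.
  have ab : a *m b = t *m t' by apply: (inW_mulI W0); rewrite !mulmxA -xa -wt -vb.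
  have Wa := inW_reflection hC ra.
  have bE : b = a *m t *m t' by rewrite -mulmxA -ab mulmxA (reflection_mul hC ra) mul1mx.
  have bt' : t' *m L = b *m L.
    apply: (inW_mulI (inW_reflection hC rb)).
    rewrite [in RHS]mulmxA (reflection_mul hC rb) mul1mx bE.
    by rewrite -!mulmxA (mulmxA t' t') (reflection_mul hC rt') mul1mx tL.
  have t'b := reflection_weight_eq hC rt' rb bt' t'L.
  apply: xw; rewrite xa wt; congr (_ *m _).
  by rewrite -[a]mulmx1 -[t]mulmx1 -(reflection_mul hC rb) !mulmxA ab t'b.
have mx : minrep C JQ x.
  case: (cover_minrep m0 ux Lx) => // cx; case: xL.
  by rewrite (coset_lamw (e j).2 W0 Wx cx).
exists (x, (e j).2); split.
- by split=> //=; apply: bruhat_trans xv t2.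
- by have := r0; rewrite /rho /= Lx; lia.
- by split.
- by split=> //=; rewrite E2 E2'.
by move/(pr_eqP (p := (x, _)) Wx W0) => [_].
Qed.

Lemma swap_down e j t : covers_chain c e -> (j.+2 <= rho_max)%N -> pr (e j) <> pr (e j.+1) ->
  pr (e j.+1) = pr (e j.+2) -> reflection C t -> (e j.+2).1 = (e j.+1).1 *m t ->
  exists x, [/\ covers_chain c (upd e j.+1 x), pr x = pr (e j) & x.1 = (e j).1 *m t].
Proof.
move=> se jN ne E rt vt; have [fe ce] := se.
have jN1 : (j.+1 <= rho_max)%N by apply: ltnW.
have [X0 X1 X2] : [/\ inX (e j), inX (e j.+1) & inX (e j.+2)].
  by split; apply: full_inX => //; lia.
have [W0 W1 W2] : [/\ W (e j).1, W (e j.+1).1 & W (e j.+2).1] by split; apply: inX_W.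
have l01 : le (e j) (e j.+1) by apply: full_le => //; lia.
have l12 : le (e j.+1) (e j.+2) by apply: full_le => //; lia.
have E2 : (e j.+1).2 = (e j.+2).2 := congr1 snd E.
have Lv := full_step_eq fe jN E2.
have r0 := full_rho fe (ltnW jN1).
have [m0 t0 I0] := X0; have [m1 _ _] := X1; have [m2 t2 I2] := X2.
have [E2'|ne2] := eqVneq (e j).2 (e j.+1).2; last first.
  have [E1 _] := full_step_neq fe jN1 (elimN eqP ne2).
  (* The lower step changes only the index set, so the Weyl group step, with the same [t], is taken
     first. *)
  pose x : elt := ((e j.+2).1, (e j).2).
  have [|||| su [Ex|Ex]] := @upd_state e j x se jN _ _ _ _ (or_intror E).
  - by [].
  - by have := r0; rewrite /rho /= Lv -E1; lia.
  - by split=> //=; rewrite E1; case: l12.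
  - by split=> /=; [apply: bruhat_refl | case: (le_prod_trans l01 l12)].
  - by exists x; split=> //=; rewrite E1.
  by case/eqP: ne2; rewrite E2; case: Ex.
have Lw := full_step_eq fe jN1 E2'.
have [uw _] := l01; have [wv _] := l12.
have [x [a [b [[xw ux xv Lx] [ra rb xa vb]]]]] := diamond_other uw wv Lw Lv.
have [t1 rt1 wt] := bruhat_cover hC uw Lw.
have Wx := bruhat_inWr hC ux.
set L := lamw (e j).2.
have tL : t *m L = L by rewrite /L E2'; apply: pr_reflection W1 W2 E vt.
have uL : (e j).1 *m L <> (e j.+1).1 *m L.
  by move=> H; apply: ne; apply/(pr_eqP W0 W1).
have t1L : t1 *m L <> L by move=> H; apply: uL; rewrite wt -mulmxA H.
have ab : a *m b = t1 *m t by apply: (inW_mulI W0); rewrite !mulmxA -xa -wt -vb.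
have [Wa Wb] := (inW_reflection hC ra, inW_reflection hC rb).
have aa := reflection_mul hC ra.
have bE : b = a *m t1 *m t by rewrite -mulmxA -ab mulmxA aa mul1mx.
have Xx : minrep C JQ x -> inX (x, (e j).2).
  by move=> mx; split=> //=; apply: bruhat_trans xv t2.
have rx : rho (x, (e j).2) = j.+1 by have := r0; rewrite /rho /= Lx; lia.
have lx1 : le (e j) (x, (e j).2) by split.
have lx2 : le (x, (e j).2) (e j.+2) by split=> //=; rewrite E2' E2.
(* In the first case [b] and a t1 a are reflections with the same nontrivial effect on [L], so they
   coincide and [a = t]. In the second, [x] would have the upper image, whence a = t1 and [x] is the
   old middle element. *)
have [xL|xL] := classic (x *m L = (e j).1 *m L).
  have aL : a *m L = L by apply: (inW_mulI W0); rewrite mulmxA -xa.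
  have aV : invmx a = a by apply: (inW_mulI Wa); rewrite mulmxV ?(inW_unit hC) // aa.
  have rc : reflection C (a *m t1 *m a) by rewrite -{2}aV; apply: reflection_conj.
  have cL : b *m L = a *m t1 *m a *m L by rewrite bE -!mulmxA aL tL.
  have bL : b *m L <> L.
    move=> bL; apply: t1L; rewrite -{2}aL -{2}bL bE -!mulmxA tL !mulmxA.
    by rewrite aa mul1mx.
  have bc := reflection_weight_eq hC rb rc cL bL.
  have ta : t = a.
    apply: (inW_mulI (inW_reflection hC rt1)); apply: (inW_mulI Wa).
    by rewrite !mulmxA -bE.
  have mx : minrep C JQ x.
    case: (cover_minrep m0 ux Lx) => // -[z [Jz xz]].
    have zt : z = t by apply: (inW_mulI W0); rewrite -xz ta.
    suff wv' : (e j.+1).1 = (e j.+2).1 by move: Lv; rewrite wv'; lia.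
    by apply: (minrep_uniq hC m1 m2); exists t; rewrite -zt; split=> //; rewrite zt.
  have [su _] := upd_state se jN (Xx mx) rx lx1 lx2 (or_intror E).
  exists (x, (e j).2); split=> //; last by rewrite ta.
  by apply/(pr_eqP (p := (x, _)) Wx W0).
(* Were [x] in the coset of [e j], then [t] would lie in W_Q, and the distinct minimal
   representatives in [e j.+1] and [e j.+2] would share a coset. *)
have mx : minrep C JQ x.
  case: (cover_minrep m0 ux Lx) => // cx; case: xL.
  by rewrite /L (coset_lamw (e j).2 W0 Wx cx).
have [su [/(pr_eqP (p := (x, _)) Wx W0)[_ //]|]] := upd_state se jN (Xx mx) rx lx1 lx2 (or_intror E).
move=> /(pr_eqP (p := (x, _)) Wx W2)[_ /= xvL].
case: xw; rewrite xa wt; congr (_ *m _).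
have bL : b *m L = L by apply: (inW_mulI Wx); rewrite mulmxA -vb.
have aL : a *m L = t1 *m L by rewrite -{1}bL mulmxA ab -mulmxA tL.
by apply: (reflection_weight_eq hC ra rt1 aL); rewrite aL.
Qed.

(* Move the lowest collapsing step of a maximal chain down to the bottom: the
   reflection realising it never changes, so it fixes all the weights it meets. *)
Lemma lowest_collapse_fixes t j e : reflection C t -> covers_chain c e -> (j < rho_max)%N ->
  (forall i, (i < j)%N -> pr (e i) <> pr (e i.+1)) -> pr (e j) = pr (e j.+1) ->
  (e j.+1).1 = (e j).1 *m t ->
  forall i, (i <= j.+1)%N -> t *m lamw (e i).2 = lamw (e i).2.
Proof.
move=> rt; elim: j e => [|j IH] e se jN Hlow E tE i ij; have [fe _] := se.
  have W0 := inX_W (full_inX fe (ltnW jN)); have W1 := inX_W (full_inX fe jN).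
  have H := pr_reflection W0 W1 E tE; have E2 : (e 0%N).2 = (e 1%N).2 := congr1 snd E.
  by case: i ij => [//|[|//]] _; rewrite -E2.
have W0 := inX_W (full_inX fe (ltnW jN)); have W1 := inX_W (full_inX fe jN).
have H := pr_reflection W0 W1 E tE; have E2 : (e j.+1).2 = (e j.+2).2 := congr1 snd E.
have ne := Hlow j (ltnSn j).
have [x [su px xt]] := swap_down se jN ne E rt tE.
case: (leqP i j) => ij'; last first.
  have [->|->] : i = j.+1 \/ i = j.+2 by lia.
    by [].
  by rewrite -E2.
have ue k : (k <= j)%N -> upd e j.+1 x k = e k by move=> kj; rewrite /upd ifN //; lia.
have ux : upd e j.+1 x j.+1 = x by rewrite /upd eqxx.
rewrite -(ue i) //; apply: IH => //.
- by lia.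
- by move=> k kj; rewrite !ue //; [apply: Hlow; lia | lia].
- by rewrite ux ue.
- by rewrite ux ue.
by lia.
Qed.

(** A termination measure: a collapsing step weighs its distance from the top, so moving one up by
    [swap_up] decreases the total. *)
Definition collapse_weight (e : nat -> elt) : nat :=
  (\sum_(k < rho_max) if pr (e k) == pr (e k.+1) then rho_max - k else 0)%N.

Lemma collapse_weight_upd e j x : (j.+2 <= rho_max)%N -> pr (e j) = pr (e j.+1) ->
  pr (e j.+1) <> pr (e j.+2) -> pr x <> pr (e j) -> pr x = pr (e j.+2) ->
  (collapse_weight (upd e j.+1 x) < collapse_weight e)%N.
Proof.
move=> jN E ne nx Ex.
pose j0 : 'I_(rho_max) := Ordinal (ltnW jN); pose j1 : 'I_(rho_max) := Ordinal jN.
have j10 : j1 != j0 by rewrite -val_eqE /=; lia.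
rewrite /collapse_weight (bigD1 j0) //= (bigD1 j1) //= [in X in (_ < X)%N](bigD1 j0) //=
  [in X in (_ < X)%N](bigD1 j1) //=.
rewrite /upd !eqxx; have -> : (j == j.+1) = false by lia.
have -> : (j.+2 == j.+1) = false by lia.
rewrite E eqxx (introF eqP ne) Ex eqxx.
have -> : (pr (e j.+1) == pr (e j.+2)) = false by apply/eqP.
rewrite !add0n -addnS.
set A := (\sum_(_ | _) _)%N; set B := (\sum_(_ | _) _)%N.
suff -> : A = B by lia.
apply: eq_bigr => k /andP[k0 k1].
have -> : (k == j.+1 :> nat) = false by apply: negbTE.
by have -> : (k.+1 == j.+1 :> nat) = false by apply: negbTE.
Qed.

(** Apply [swap_up] while some collapsing step is followed by a noncollapsing one. Once none is, the
    reflection of the lowest collapsing step fixes every weight of the chain, so it lies in W_Q. *)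
Lemma state_no_collapse e j : covers_chain c e -> (j < rho_max)%N -> pr (e j) <> pr (e j.+1).
Proof.
have [k] := ubnP (collapse_weight e); elim: k e j => // k IHk e j wk se jN E.
have [[i [iN Ei nei]]|H] := classic (exists i, [/\ (i.+2 <= rho_max)%N, pr (e i) = pr (e i.+1) &
    pr (e i.+1) <> pr (e i.+2)]).
  have [x [su nx Ex]] := swap_up se iN Ei nei.
  have := @IHk _ i.+1 _ su iN; apply.
    exact: leq_trans (collapse_weight_upd iN Ei nei nx Ex) wk.
  by rewrite /upd eqxx; have -> : (i.+2 == i.+1) = false by lia.
have [fe _] := se.
have ex : exists i, (i < rho_max)%N && (pr (e i) == pr (e i.+1)) by exists j; rewrite jN E eqxx.
case: (ex_minnP ex) => {jN E} {}j /andP[jN /eqP E] Hmin.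
have low i : (i < j)%N -> pr (e i) <> pr (e i.+1).
  by move=> ij Ei; have := Hmin i; rewrite Ei eqxx andbT; lia.
have up i : (j <= i < rho_max)%N -> pr (e i) = pr (e i.+1).
  elim: i => [|i IH] ijN; first by have -> : 0%N = j by lia.
  have [<-//|ne] := eqVneq j i.+1.
  apply: NNPP => nei; apply: H; exists i; split=> //; first by lia.
  by apply: IH; lia.
have W0 := inX_W (full_inX fe (ltnW jN)); have W1 := inX_W (full_inX fe jN).
have l01 : (e j).1 ≤ (e j.+1).1 by have [] : le (e j) (e j.+1) by apply: full_le => //; lia.
have Lw := full_step_eq fe jN (congr1 snd E).
have [t rt tE] := bruhat_cover hC l01 Lw.
have fx := lowest_collapse_fixes rt se jN low E tE.
(* Above the lowest collapse every step collapses, so the index set no longer changes. *)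
have fx' i : (i <= rho_max)%N -> t *m lamw (e i).2 = lamw (e i).2.
  elim: i => [|i IH] iN; first exact: fx.
  case: (leqP i.+1 j.+1) => ij; first exact: fx.
  have Ei : (e i).2 = (e i.+1).2 := congr1 snd (up i _).
  by rewrite -Ei ?IH //; lia.
have Jt := full_fix_JQ fe (inW_reflection hC rt) fx'.
have [[m0 _ _] [m1 _ _]] := (full_inX fe (ltnW jN), full_inX fe jN).
suff Ee : (e j).1 = (e j.+1).1 by rewrite Ee in Lw; lia.
by apply: (minrep_uniq hC m0 m1); exists t.
Qed.

(** * Uniqueness, maximality and extremality of the defining chain *)

Lemma state_inj e i j : covers_chain c e -> (i < j <= rho_max)%N -> pr (e i) <> pr (e j).
Proof.
move=> se ij E; have [fe _] := se.
apply: (@state_no_collapse e i se); first by lia.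
symmetry; apply: pr_squeeze (full_inX fe _) (full_inX fe _) (full_inX fe _) _ _ E; try lia;
  by apply: full_le => //; lia.
Qed.

(** Extend [d] to a full chain [e]. Its images are pairwise distinct and all lie in [c], whose
    elements are images of entries of [d]; so every rank occurs in [d]. *)
Lemma defining_full d : defining C II lam tau c d -> size d = rho_max.+1 /\ full_chain (nth elt0 d).
Proof.
move=> dd; have [sz Wd _] := dd; have [Xd _] := Wd.
have Xi k : (k < size d)%N -> inX (nth elt0 d k) by move=> ks; apply: Xd; apply: mem_nth.
have [e fe ed] := Wchain_extend Wd.
have se : covers_chain c e.
  split=> // p /(nthP elt0)[k kc <-]; exists (rho (nth elt0 d k)).
    by apply: rho_le_N; apply: Xi; rewrite sz.
  by rewrite (defining_pr dd kc) ed // sz.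
pose r := [seq rho p | p <- d].
have rE : r = iota 0 rho_max.+1.
  apply: (irr_sorted_eq ltn_trans ltnn); last first.
  - move=> k; rewrite mem_iota add0n ltnS; apply/mapP/idP => [[p pd ->]|kN].
      by apply: rho_le_N; apply: Xd.
    have /(nthP elt0)[i ic Ei] := state_image se kN.
    rewrite (defining_pr dd ic) in Ei.
    have id' : (i < size d)%N by rewrite sz.
    exists (nth elt0 d i); first exact: mem_nth.
    rewrite -ed // in Ei; have rN := rho_le_N (Xi i id').
    case: (ltngtP k (rho (nth elt0 d i))) => // lt; exfalso.
      by apply: (@state_inj e _ _ se _ (esym Ei)); lia.
    by apply: (@state_inj e _ _ se _ Ei); lia.
  - exact: iota_ltn_sorted.
  apply/(sortedP 0%N) => i; rewrite size_map => id'.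
  by rewrite !(nth_map elt0) //; [apply: Wchain_rho => //; lia | lia].
have szd : size d = rho_max.+1 by rewrite -(size_map rho) -/r rE size_iota.
split=> //; split=> k kN; last by apply: Wchain_le => //; rewrite szd; lia.
split; first by apply: Xi; rewrite szd; lia.
rewrite -(nth_map elt0 0%N) ?szd; last by lia.
by rewrite -/r rE nth_iota; lia.
Qed.

(** Both chains start at the identity. Going up, a step either changes only the index set, or
    multiplies by a reflection that moves the weight and is determined by its effect there. *)
Lemma defining_inj d d' : defining C II lam tau c d -> defining C II lam tau c d' -> d = d'.
Proof.
move=> dd dd'; have [sz fd] := defining_full dd; have [sz' fd'] := defining_full dd'.
have [szc _ Hd] := dd; have [_ _ Hd'] := dd'.
apply: (@eq_from_nth _ elt0); first by rewrite sz.
rewrite sz => k; rewrite ltnS; elim: k => [|k IH] kN.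
  have r0 := rho0 (full_inX fd kN) (full_rho fd kN).
  have r0' := rho0 (full_inX fd' kN) (full_rho fd' kN).
  rewrite [LHS]surjective_pairing [RHS]surjective_pairing r0 r0'.
  have c0 : (0 < size c)%N by rewrite -szc sz.
  by have [-> _] := Hd _ c0; have [-> _] := Hd' _ c0.
have {}IH := IH (ltnW kN).
have kc : (k.+1 < size c)%N by rewrite -szc sz.
have E := defining_pr dd kc; have E' := defining_pr dd' kc.
have ne : pr (nth elt0 d k) <> pr (nth elt0 d k.+1).
  rewrite -!(defining_pr dd) //; last exact: ltnW.
  by case: c_max => -[[_ Hc] _] _ E3; case: (Hc k kc) => _; apply.
have prE : pr (nth elt0 d k.+1) = pr (nth elt0 d' k.+1) by rewrite -E.
have E2 : (nth elt0 d k.+1).2 = (nth elt0 d' k.+1).2 := congr1 snd prE.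
have W0 := inX_W (full_inX fd (ltnW kN)).
have W1 := inX_W (full_inX fd kN); have W1' := inX_W (full_inX fd' kN).
rewrite [LHS]surjective_pairing [RHS]surjective_pairing -E2; congr (_, _).
have [Ek|nek] := eqVneq (nth elt0 d k).2 (nth elt0 d k.+1).2; last first.
  have [E1 _] := full_step_neq fd kN (elimN eqP nek).
  have nek' : (nth elt0 d' k).2 <> (nth elt0 d' k.+1).2 by rewrite -IH -E2; apply/eqP.
  by have [E1' _] := full_step_neq fd' kN nek'; rewrite -E1 -E1' IH.
have Lw := full_step_eq fd kN Ek.
have Lw' : len (nth elt0 d' k.+1).1 = (len (nth elt0 d' k).1).+1.
  by apply: full_step_eq fd' kN _; rewrite -IH Ek.
have [l1 _] : le (nth elt0 d k) (nth elt0 d k.+1) by apply: full_le fd _; lia.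
have [l1' _] : le (nth elt0 d' k) (nth elt0 d' k.+1) by apply: full_le fd' _; lia.
have [a ra Ea] := bruhat_cover hC l1 Lw; have [b rb Eb] := bruhat_cover hC l1' Lw'.
rewrite -IH in Eb; rewrite Ea Eb; congr (_ *m _).
set L := lamw (nth elt0 d k).2.
have [_ wE] := (proj1 (pr_eqP W1 W1') prE); rewrite -Ek -/L Ea Eb -!mulmxA in wE.
apply: (reflection_weight_eq hC ra rb (inW_mulI W0 wE)) => aL.
apply: ne; apply/(pr_eqP W0 W1); split=> //.
by rewrite Ea -mulmxA -/L aL.
Qed.

(** A monotone change of representatives below [tau] that preserves the images gives a defining
    chain again, which [defining_inj] identifies with [d]. *)
Lemma defining_mkseq d f : defining C II lam tau c d ->
  (forall r, (r < size c)%N -> [/\ minrep C JQ (f r), f r ≤ tau &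
     same_coset C (JP (nth elt0 d r).2) (nth elt0 d r).1 (f r)]) ->
  (forall r, (r.+1 < size c)%N -> f r ≤ f r.+1) ->
  forall r, (r < size c)%N -> (nth elt0 d r).1 = f r.
Proof.
move=> dd H1 H2; have [sz Wd Hd] := dd; have [Xd Hd'] := Wd.
have Xi k : (k < size c)%N -> inX (nth elt0 d k).
  by move=> kc; apply: Xd; apply: mem_nth; rewrite sz.
pose g r : elt := (f r, (nth elt0 d r).2).
suff dg : defining C II lam tau c (mkseq g (size c)).
  by move=> r rc; rewrite (defining_inj dd dg) nth_mkseq.
have prg r : (r < size c)%N -> pr (g r) = nth elt0 c r.
  move=> rc; rewrite (defining_pr dd rc) /pr /=; congr (_, _).
  by have [_ _ /(mr_eq hC)->] := H1 r rc; rewrite //; apply: inX_W; apply: Xi.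
have Xg r : (r < size c)%N -> inX (g r).
  by move=> rc; have [mf ft _] := H1 r rc; split=> //; case: (Xi r rc).
split; first by rewrite size_mkseq.
  split=> [p /mapP[r]|k]; first by rewrite mem_iota => /andP[_ rc] ->; apply: Xg.
  rewrite size_mkseq => kc; rewrite !nth_mkseq //; last exact: ltnW.
  split; first by split; [apply: H2 | case: (Wchain_le (i := k) (j := k.+1) Wd) => //; rewrite sz; lia].
  move=> /(congr1 pr); rewrite !prg //; last exact: ltnW.
  by case: c_max => -[[_ Hc] _] _ E3; case: (Hc k kc) => _; apply.
move=> r rc; rewrite nth_mkseq //= -(prg r rc) /=; split=> //.
exact: pr_proj (inX_W (Xg r rc)).
Qed.

(** [d] meets every rank, and two elements of one chain with the same rank coincide. *)
Lemma defining_maximal d : defining C II lam tau c d -> Wmaximal C II lam tau d.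
Proof.
move=> dd; have [sz fd] := defining_full dd; have [_ Wd _] := dd.
split=> // d' Wd' dd' p pd'; have [Xd' _] := Wd'.
have pN := rho_le_N (Xd' p pd'); have pd : (rho p < size d)%N by rewrite sz.
have /dd' qd' := mem_nth elt0 pd.
have rq := full_rho fd pN.
move: pd' qd' => /(nthP elt0)[i id' Ei] /(nthP elt0)[j jd' Ej].
have [ij|ij|ij] := ltngtP i j.
- by have := @Wchain_rho d' i j Wd'; rewrite ij jd' Ei Ej rq ltnn => /(_ isT).
- by have := @Wchain_rho d' j i Wd'; rewrite ij id' Ei Ej rq ltnn => /(_ isT).
by rewrite -Ei ij Ej; apply: mem_nth.
Qed.

Lemma defining_low d k : defining C II lam tau c d -> (k < size c)%N ->
  isMinJ C JQ (Qlow II lam c k) (nth elt0 d k).1.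
Proof.
move=> dd kc; have [sz fd] := defining_full dd; have [szc Wd Hd] := dd; have [Xd _] := Wd.
set Q := Qlow II lam c k.
have Xi r : (r < size c)%N -> inX (nth elt0 d r).
  by move=> rc; apply: Xd; apply: mem_nth; rewrite szc.
have JQ_Q : JQ \subset Q by apply/bigcapsP=> r _; apply: JQ_JP.
(* For [r <= k] the subset [Q] lies in each [JP] concerned, so images are kept; minimal
   representatives also keep the sequence increasing at the junction. *)
pose f r := if (r <= k)%N then mr C Q (nth elt0 d r).1 else (nth elt0 d r).1.
have dle r : (r.+1 < size c)%N -> (nth elt0 d r).1 ≤ (nth elt0 d r.+1).1.
  by move=> rc; case: (Wchain_le (i := r) (j := r.+1) Wd) => //; rewrite szc; lia.
have := @defining_mkseq d f dd _ _ k kc; rewrite /f leqnn => E.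
have {E}-> : (nth elt0 d k).1 = mr C Q (nth elt0 d k).1.
  apply: E => r rc.
    have Wr := inX_W (Xi r rc); have [mr_ rt rI] := Xi r rc.
    case: leqP => rk'; last by split=> //; apply: same_coset_refl.
    split; first exact: (minrep_sub hC JQ_Q (mr_minrep hC Q Wr)).
      exact: bruhat_trans (mr_le hC _ Wr) rt.
    apply: same_coset_sub (mr_coset hC Q Wr).
    have [-> _] := Hd r rc.
    by apply: (bigcap_inf (Ordinal rc)).
  have Wr := inX_W (Xi r (ltnW rc)).
  case: (leqP r.+1 k) => rk'; first by rewrite (ltnW rk'); apply: mr_mono => //; apply: dle.
  case: leqP => rk''; last exact: dle.
  exact: bruhat_trans (mr_le hC _ Wr) (dle r rc).
by apply: (minrep_isMinJ hC JQ_Q); apply: (mr_minrep hC); apply: inX_W; apply: Xi.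
Qed.

Lemma defining_high d Jt k : IsQtau C lam tau Jt -> defining C II lam tau c d ->
  (k < size c)%N -> isMaxJ C JQ (Qhigh II lam Jt c k) (nth elt0 d k).1.
Proof.
move=> [JQJt [_ tau_max] _] dd kc.
have [sz fd] := defining_full dd; have [szc Wd Hd] := dd; have [Xd _] := Wd.
set Q := Qhigh II lam Jt c k.
have Xi r : (r < size c)%N -> inX (nth elt0 d r).
  by move=> rc; apply: Xd; apply: mem_nth; rewrite szc.
have JQ_Q : JQ \subset Q by rewrite subsetI JQJt; apply/bigcapsP=> r _; apply: JQ_JP.
(* Since [Q] is contained in [Jt], [tau] is also [Q]-maximal, and this keeps the new elements below
   [tau]. *)
have tauQ : isMaxJ C JQ Q tau.
  split=> // v mv cv; apply: tau_max => //; apply: same_coset_sub cv; exact: subsetIl.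
pose g w := epsilon (inhabits 1%:M) (fun v => isMaxJ C JQ Q v /\ same_coset C Q w v).
have gP w : W w -> isMaxJ C JQ Q (g w) /\ same_coset C Q w (g w).
  move=> Ww; apply: (epsilon_spec (inhabits 1%:M) (fun v => isMaxJ C JQ Q v /\ same_coset C Q w v)).
  by have [v] := ex_isMaxJ hC JQ_Q Ww; exists v.
pose f r := if (k <= r)%N then g (nth elt0 d r).1 else (nth elt0 d r).1.
have dle r : (r.+1 < size c)%N -> (nth elt0 d r).1 ≤ (nth elt0 d r.+1).1.
  by move=> rc; case: (Wchain_le (i := r) (j := r.+1) Wd) => //; rewrite szc; lia.
have := @defining_mkseq d f dd _ _ k kc; rewrite /f leqnn => E.
have {E}-> : (nth elt0 d k).1 = g (nth elt0 d k).1.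
  apply: E => r rc.
    have Wr := inX_W (Xi r rc); have [mr_ rt rI] := Xi r rc.
    case: leqP => rk'; last by split=> //; apply: same_coset_refl.
    have [gM gc] := gP _ Wr; split; first by case: gM.
      exact: (isMaxJ_mono hC JQ_Q rt gM tauQ gc (same_coset_refl _ _ _)).
    apply: same_coset_sub gc.
    have [-> _] := Hd r rc.
    by apply: subset_trans (subsetIr _ _) _; apply: (bigcap_inf (Ordinal rc)).
  have Wr := inX_W (Xi r (ltnW rc)); have Wr' := inX_W (Xi _ rc).
  have [gM gc] := gP _ Wr; have [gM' gc'] := gP _ Wr'.
  case: (leqP k r) => rk'.
    by rewrite (leqW rk'); apply: (isMaxJ_mono hC JQ_Q (dle r rc) gM gM' gc gc').
  case: leqP => rk''; last exact: dle.
  apply: bruhat_trans (dle r rc) _; case: gM' => _; apply; first by case: (Xi _ rc).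
  exact: (same_coset_sym hC).
by case: (gP _ (inX_W (Xi k kc))).
Qed.

Lemma maximal_standard_defining :
  (exists! d, defining C II lam tau c d) /\
  forall d, defining C II lam tau c d ->
    [/\ Wmaximal C II lam tau d,
        nth elt0 d (size d).-1 = (tau, setT),
        nth elt0 d 0 = (1%:M, (nth elt0 c 0).2),
        (exists r, is_length C tau r /\ size d = (r + m)%N) &
        forall Jt, IsQtau C lam tau Jt ->
          forall k, (k < size c)%N ->
            isMinJ C JQ (Qlow II lam c k) (nth elt0 d k).1 /\
            isMaxJ C JQ (Qhigh II lam Jt c k) (nth elt0 d k).1].
Proof.
split.
  have [[_ [d dd]] _] := c_max; exists d; split=> // d'; exact: defining_inj.
move=> d dd; have [sz fd] := defining_full dd; have [szc _ Hd] := dd.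
split.
- exact: defining_maximal.
- by rewrite sz /= (full_top fd).
- have c0 : (0 < size c)%N by rewrite -szc sz.
  rewrite [LHS]surjective_pairing (rho0 (full_inX fd (leq0n rho_max)) (full_rho fd (leq0n rho_max))).
  by have [-> _] := Hd _ c0.
- exists (len tau); split; first exact: is_lengthP.
  by rewrite sz /rho_max; lia.
by move=> Jt hJt k kc; split; [apply: defining_low | apply: defining_high].
Qed.

End Maximal.

End Chains.

Theorem mainTheorem4 (n : nat) (C : 'M[int]_n) (m : nat)
  (II : {set {set 'I_m}}) (lam : 'I_m -> 'I_n -> nat) (tau : 'M[int]_n) :
  (0 < n)%N -> finite_type_cartan C -> (0 < m)%N -> index_family II ->
  minrep C (JQ lam) tau ->
  forall c : seq (elt n m),
    maximal_standard C II lam tau c ->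
    (exists! d, defining C II lam tau c d) /\
    forall d, defining C II lam tau c d ->
      [/\ Wmaximal C II lam tau d,
          nth (elt0 n m) d (size d).-1 = (tau, setT),
          nth (elt0 n m) d 0 = (1%:M, (nth (elt0 n m) c 0).2),
          (exists r, is_length C tau r /\ size d = (r + m)%N) &
          forall Jt, IsQtau C lam tau Jt ->
            forall k, (k < size c)%N ->
              isMinJ C (JQ lam) (Qlow II lam c k) (nth (elt0 n m) d k).1 /\
              isMaxJ C (JQ lam) (Qhigh II lam Jt c k) (nth (elt0 n m) d k).1].
Proof.
move=> _ hC m_gt0 [_ IIT [rk [rk_min rk_covby rk_max]] _] tau_min c c_max.
exact: (maximal_standard_defining hC m_gt0 IIT rk_min rk_covby rk_max tau_min c_max).
Qed.
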